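(* Let $G$ be a lattice of the three-dimensional real Heisenberg group $\mathcal{H}$. Then there exists a $G$-invariant open set $\Omega\subset\mathbb{P}^2_{\mathbb{C}}$ such that $\Omega/G$ is diffeomorphic to $(\mathcal{H}/G)\times\mathbb{R}$.
   Context: $\mathcal{H}$ is the group of real matrices $\begin{pmatrix}1&a&c\\0&1&b\\0&0&1\end{pmatrix}$, $a,b,c\in\mathbb{R}$, under matrix multiplication. It acts on the complex projective plane $\mathbb{P}^2_{\mathbb{C}}$ by projective transformations, $\gamma\cdot[\mathbf{w}]=[\gamma\mathbf{w}]$ for $\mathbf{w}\in\mathbb{C}^3\setminus\{0\}$; $G\subset\mathcal{H}$ acts by restriction. $\mathcal{H}/G$ denotes the quotient of $\mathcal{H}$ by the left-multiplication action of $G$. *)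

(* Defs.v *)
From HB Require Import structures.
From mathcomp Require Import all_boot all_order all_algebra.
From mathcomp Require Import complex ring.
From mathcomp Require Import all_classical all_reals all_analysis.
Set Implicit Arguments.
Unset Strict Implicit.
Unset Printing Implicit Defensive.
Import Order.TTheory GRing.Theory Num.Theory numFieldNormedType.Exports.
Local Open Scope classical_set_scope.
Local Open Scope ring_scope.
Local Open Scope quotient_scope.

(* The quotient of [S] that identifies [x] and [y] when [orb x = orb y]; here
   [orb x] is meant to be the orbit of [x] under a group acting on [S], so that
   equality of orbits is the orbit equivalence relation.  The ambient type [T]
   of the orbits differs from [S] when [S] is a subset of [T] seen as a type. *)
Section OrbitSpace.
Context {S : topologicalType} {T : Type} (orb : S -> set T).

Definition same_orbit : rel S := fun x y => `[< orb x = orb y >].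

Lemma same_orbit_equiv : equiv_class_of same_orbit.
Proof.
split.
- by move=> x; apply/asboolP.
- by move=> x y; apply/asboolP/asboolP.
- by move=> y x z /asboolP xy /asboolP yz; apply/asboolP; rewrite xy.
Qed.

Canonical same_orbit_equivRel := EquivRelPack same_orbit_equiv.

Definition orbit_space := quotient_topology {eq_quot same_orbit_equivRel}.

HB.instance Definition _ := Topological.on orbit_space.

Definition orbit_proj (x : S) : orbit_space := \pi_{eq_quot same_orbit_equivRel} x.

Definition orbit_repr (p : orbit_space) : S :=
  repr (p : {eq_quot same_orbit_equivRel}).

Lemma orbit_projP (x y : S) : orbit_proj x = orbit_proj y <-> orb x = orb y.
Proof.
by split=> [/eqmodP/asboolP|xy] //; apply/eqmodP/asboolP.
Qed.

Lemma orbit_reprK : cancel orbit_repr orbit_proj.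
Proof. by move=> p; exact: reprK. Qed.

Lemma orbit_openE (A : set orbit_space) : open A = open (orbit_proj @^-1` A).
Proof. by []. Qed.

End OrbitSpace.

HB.instance Definition _ (S : ptopologicalType) (T : Type) (orb : S -> set T) :=
  isPointed.Build (orbit_space orb) (orbit_proj orb point).

Section Smooth.
Context {R : realType}.

Fixpoint Ck (k : nat) (m n : nat) (U : set 'rV[R]_m)
    (f : 'rV[R]_m -> 'rV[R]_n) : Prop :=
  if k is k'.+1 then
    (forall x, U x -> differentiable f x) /\
    (forall v : 'rV[R]_m, Ck k' U (fun x => 'D_v f x))
  else forall x, U x -> {for x, continuous f}.

(* Only used for open [U]; the values of [f] outside [U] are irrelevant. *)
Definition smooth_on (m n : nat) (U : set 'rV[R]_m)
    (f : 'rV[R]_m -> 'rV[R]_n) : Prop := forall k, Ck k U f.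

(* The values of [chart_map] outside [chart_dom] are irrelevant. *)
Record chart (T : Type) (n : nat) := Chart {
  chart_dom : set T;
  chart_map :> T -> 'rV[R]_n }.

(* A homeomorphism from an open set of [T] onto an open set of R^n. *)
Definition is_chart (T : topologicalType) (n : nat) (c : chart T n) : Prop :=
  [/\ open (chart_dom c),
      {in chart_dom c &, injective c}
    & forall A, A `<=` chart_dom c -> open A <-> open (c @` A)].

(* [g] is the transition map d o c^-1. *)
Definition compatible (T : Type) (n : nat) (c d : chart T n) : Prop :=
  exists g : 'rV[R]_n -> 'rV[R]_n,
    smooth_on (c @` (chart_dom c `&` chart_dom d)) g /\
    forall x, chart_dom c x -> chart_dom d x -> g (c x) = d x.

Definition smooth_atlas (T : topologicalType) (n : nat)
    (A : set (chart T n)) : Prop :=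
  [/\ hausdorff_space T,
      @second_countable T,
      (forall c, A c -> is_chart c),
      (forall x, exists2 c, A c & chart_dom c x)
    & (forall c d, A c -> A d -> compatible c d)].

(* [g] is the coordinate expression d o f o c^-1 of [f]. *)
Definition smooth_map (T T' : topologicalType) (n n' : nat)
    (A : set (chart T n)) (B : set (chart T' n')) (f : T -> T') : Prop :=
  continuous f /\
  forall c d, A c -> B d ->
  exists g : 'rV[R]_n -> 'rV[R]_n',
    smooth_on (c @` (chart_dom c `&` f @^-1` chart_dom d)) g /\
    forall x, chart_dom c x -> chart_dom d (f x) -> g (c x) = d (f x).

Definition diffeomorphic (T T' : topologicalType) (n n' : nat)
    (A : set (chart T n)) (B : set (chart T' n')) : Prop :=
  [/\ smooth_atlas A, smooth_atlas B &
    exists (f : T -> T') (g : T' -> T),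
      [/\ cancel f g, cancel g f, smooth_map A B f & smooth_map B A g]].

Definition subset_atlas (T : topologicalType) (n : nat) (A : set (chart T n))
    (U : set T) : set (chart (set_type U) n) :=
  [set e | exists2 c, A c &
     e = Chart (set_val @^-1` chart_dom c) (c \o set_val)].

(* The charts c o (orbit_proj|_W)^-1, for W an open subset of the domain of a
   chart c on which the projection to the orbit space is injective.  For this
   to be an atlas, the projection must be locally injective. *)
Definition orbit_atlas (S : topologicalType) (T : Type) (orb : S -> set T)
    (n : nat) (A : set (chart S n)) : set (chart (orbit_space orb) n) :=
  [set e | exists (c : chart S n) (W : set S),
     [/\ A c, open W, W `<=` chart_dom c,
         {in W &, injective (orbit_proj orb)}
       & chart_dom e = orbit_proj orb @` W /\
         forall x, W x -> e (orbit_proj orb x) = c x]].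

Definition prod_atlas (T T' : topologicalType) (n n' : nat)
    (A : set (chart T n)) (B : set (chart T' n')) :
    set (chart (T * T')%type (n + n')) :=
  [set e | exists c d, [/\ A c, B d &
     e = Chart (chart_dom c `*` chart_dom d)
               (fun p => row_mx (c p.1) (d p.2))]].

Definition real_atlas : set (chart (R : topologicalType) 1) :=
  [set Chart setT (fun t : R => \row_(_ < 1) t)].

End Smooth.

Arguments orbit_atlas {R S T} orb {n} A.

Section Heisenberg.
Context {R : realType}.

Definition heis_mx (a b c : R) : 'M[R]_3 :=
  \matrix_(i < 3, j < 3)
    nth 0 (nth [::] [:: [:: 1; a; c];
                        [:: 0; 1; b];
                        [:: 0; 0; 1]] i) j.

Definition heis_set : set 'M[R]_3 := [set A | exists a b c, A = heis_mx a b c].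

Lemma heis_mx1 : heis_mx 0 0 0 = 1%:M.
Proof. by apply/matrixP => -[[|[|[|//]]] ?] [[|[|[|//]]] ?]; rewrite !mxE. Qed.

Lemma heis_mxM a b c a' b' c' :
  heis_mx a b c *m heis_mx a' b' c' =
  heis_mx (a + a') (b + b') (c + a * b' + c').
Proof.
by apply/matrixP => -[[|[|[|//]]] ?] [[|[|[|//]]] ?];
  rewrite !mxE !big_ord_recl big_ord0 !mxE /=; ring.
Qed.

Lemma heis_mxV a b c : invmx (heis_mx a b c) = heis_mx (- a) (- b) (a * b - c).
Proof.
have e : heis_mx a b c *m heis_mx (- a) (- b) (a * b - c) = 1%:M.
  by rewrite heis_mxM -heis_mx1 !subrr mulrN addrA subrK subrr.
have [u _] := mulmx1_unit e.
by rewrite -[LHS]mulmx1 -e mulmxA mulVmx// mul1mx.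
Qed.

Lemma heis_set1 : 1%:M \in heis_set.
Proof. by rewrite inE; exists 0, 0, 0; rewrite heis_mx1. Qed.

Lemma heis_setM A B : A \in heis_set -> B \in heis_set -> A *m B \in heis_set.
Proof.
rewrite !inE => -[a [b [c ->]]] [a' [b' [c' ->]]].
by do 3 eexists; rewrite heis_mxM.
Qed.

Lemma heis_setV A : A \in heis_set -> invmx A \in heis_set.
Proof.
by rewrite !inE => -[a [b [c ->]]]; do 3 eexists; rewrite heis_mxV.
Qed.

Lemma heis_unit A : A \in heis_set -> A \in unitmx.
Proof.
rewrite inE => -[a [b [c ->]]].
have e : heis_mx a b c *m heis_mx (- a) (- b) (a * b - c) = 1%:M.
  by rewrite heis_mxM -heis_mx1 !subrr mulrN addrA subrK subrr.
by have [] := mulmx1_unit e.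
Qed.

End Heisenberg.

Definition heis (R : realType) : Type := set_type (@heis_set R).

HB.instance Definition _ (R : realType) :=
  Topological.copy (heis R) (set_type (@heis_set R)).

Section HeisenbergGroup.
Context {R : realType}.
Implicit Types g h : heis R.

Definition heis_val g : 'M[R]_3 := set_val g.

Definition heis_one : heis R := exist _ 1%:M heis_set1.
Definition heis_mul g h : heis R :=
  exist _ (heis_val g *m heis_val h) (heis_setM (valP g) (valP h)).
Definition heis_inv g : heis R :=
  exist _ (invmx (heis_val g)) (heis_setV (valP g)).

Lemma heis_mulA : associative heis_mul.
Proof. by move=> g h k; apply/val_inj; exact: mulmxA. Qed.
Lemma heis_mul1 : left_id heis_one heis_mul.
Proof. by move=> g; apply/val_inj; exact: mul1mx. Qed.
Lemma heis_mulr1 : right_id heis_one heis_mul.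
Proof. by move=> g; apply/val_inj; exact: mulmx1. Qed.
Lemma heis_mulV : left_inverse heis_one heis_inv heis_mul.
Proof. by move=> g; apply/val_inj/mulVmx/heis_unit/valP. Qed.
Lemma heis_mulrV : right_inverse heis_one heis_inv heis_mul.
Proof. by move=> g; apply/val_inj/mulmxV/heis_unit/valP. Qed.

End HeisenbergGroup.

HB.instance Definition _ (R : realType) := isGroup.Build (heis R)
  heis_mulA heis_mul1 heis_mulr1 heis_mulV heis_mulrV.
HB.instance Definition _ (R : realType) := isPointed.Build (heis R) 1%g.

Section Lattice.
Context {R : realType}.
Implicit Type G : set (heis R).

(* The global coordinates (a, b, c) of H. *)
Definition heis_atlas : set (chart (R := R) (heis R) 3) :=
  [set Chart setT (fun h : heis R =>
     let A := heis_val h in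
     \row_(k < 3) nth 0 [:: A 0 1; A 1 2%:R; A 0 2%:R] k)].

Definition heis_orbit G (h : heis R) : set (heis R) := [set (g * h)%g | g in G].

Definition heis_quotient G : ptopologicalType := orbit_space (heis_orbit G).

Definition heis_quotient_atlas G : set (chart (R := R) (heis_quotient G) 3) :=
  orbit_atlas (heis_orbit G) heis_atlas.

Definition heis_rtrans G (h : heis R) (x : heis_quotient G) : heis_quotient G :=
  orbit_proj (heis_orbit G) (orbit_repr x * h)%g.

(* A nonzero finite Borel measure on H/G invariant under the right action of H:
   up to scaling, the measure induced by Haar measure. *)
Definition finite_covolume G : Prop :=
  exists mu : {measure set (g_sigma_algebraType (@open (heis_quotient G)))
                 -> \bar R},
    (0 < mu setT < +oo)%E /\
    forall (h : heis R) (A : set (heis_quotient G)),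
      (@open (heis_quotient G)).-sigma.-measurable A ->
      mu (heis_rtrans h @^-1` A) = mu A.

Definition lattice G : Prop :=
  [/\ group_closed [in G], G `<=` isolated G & finite_covolume G].

End Lattice.

(* R[i] with its usual topology, given by the modulus. *)
Definition Cplx (R : realType) : numFieldType := R[i]%C.

Section ProjectivePlane.
Context {R : realType}.
Local Notation C := (Cplx R).

Definition punctured : set 'cV[C]_3 := [set w | w != 0].

Definition scaling_orbit (w : set_type punctured) : set 'cV[C]_3 :=
  [set l *: set_val w | l in [set l : C | l != 0]].

Definition projective_plane : topologicalType := orbit_space scaling_orbit.

Definition proj_class : set_type punctured -> projective_plane :=
  orbit_proj scaling_orbit.

Definition complexify (A : 'M[R]_3) : 'M[C]_3 :=
  map_mx (fun x : R => (x%:C)%C : C) A.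

Lemma heis_act_subproof (g : heis R) (w : set_type punctured) :
  complexify (heis_val g) *m set_val w \in punctured.
Proof.
have /set_mem /= w0 := valP w; rewrite inE /=; apply: contra w0 => /eqP gw0.
have gu : complexify (heis_val g) \in unitmx.
  by rewrite /complexify (map_unitmx (@real_complex R)) heis_unit// (valP g).
by apply/eqP; rewrite -[LHS](mulKmx gu) gw0 mulmx0.
Qed.

Definition heis_act_vec (g : heis R) (w : set_type punctured) :
    set_type punctured :=
  exist (fun v => v \in punctured) _ (heis_act_subproof g w).

Definition heis_act (g : heis R) (p : projective_plane) : projective_plane :=
  proj_class (heis_act_vec g (orbit_repr p)).

Lemma heis_actE g w : heis_act g (proj_class w) = proj_class (heis_act_vec g w).
Proof.
apply/orbit_projP; set w' := orbit_repr _.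
have /orbit_projP e : proj_class w' = proj_class w by exact: orbit_reprK.
have [l /= l0 lE] : scaling_orbit w (set_val w').
  by rewrite -e; exists 1; rewrite /= ?oner_eq0 ?scale1r.
apply/seteqP; split=> _ [k /= k0 <-].
- by exists (k * l); rewrite /= ?mulf_neq0// !set_valE /= -lE -scalemxAr scalerA.
- exists (k / l); first by rewrite /= mulf_neq0 ?invr_eq0.
  by rewrite !set_valE /= -lE -scalemxAr scalerA divfK.
Qed.

Definition affine_chart (i : 'I_3) : chart (R := R) projective_plane 4 :=
  Chart [set p | (set_val (orbit_repr p) : 'cV[C]_3) i 0 != 0]
    (fun p => let w : 'cV[C]_3 := set_val (orbit_repr p) in
       row_mx (\row_(j < 2) complex.Re (w (lift i j) 0 / w i 0))
              (\row_(j < 2) complex.Im (w (lift i j) 0 / w i 0))).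

Definition projective_atlas : set (chart (R := R) projective_plane 4) :=
  range affine_chart.

Definition proj_orbit (G : set (heis R)) (Omega : set projective_plane)
    (x : set_type Omega) : set projective_plane :=
  [set heis_act g (set_val x) | g in G].

Definition domain_quotient G Omega : topologicalType :=
  orbit_space (@proj_orbit G Omega).

Definition domain_quotient_atlas G Omega :
    set (chart (R := R) (domain_quotient G Omega) 4) :=
  orbit_atlas (@proj_orbit G Omega) (subset_atlas projective_atlas (U := Omega)).

Definition invariant_set (G : set (heis R)) (Omega : set projective_plane) : Prop :=
  forall g, G g -> heis_act g @` Omega = Omega.

End ProjectivePlane.

Arguments projective_plane R : clear implicits.
Arguments domain_quotient {R} G Omega.
Arguments domain_quotient_atlas {R} G Omega.
Arguments invariant_set {R} G Omega.
Arguments heis_quotient_atlas {R} G.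

(* Main.v *)
Require Import Defs.
From mathcomp Require Import all_boot all_order all_algebra.
From mathcomp Require Import complex ring.
From mathcomp Require Import all_classical all_reals all_analysis.
Set Implicit Arguments.
Unset Strict Implicit.
Unset Printing Implicit Defensive.
Import Order.TTheory GRing.Theory Num.Theory numFieldNormedType.Exports.

(* The element of [H] with entries [a, b, c] sends the point [0 : i e^t : 1] to
   [c + i a e^t : b + i e^t : 1], so that [(a, b, c, t) |-> h . [0 : i e^t : 1]]
   is a diffeomorphism from [H x R] onto the open set [Omega] of the points
   [w] with [Im (w_1 / w_2) > 0], which turns left multiplication on [H] into
   the projective action.  Hence [Omega / G] and [(H / G) x R] are both
   quotients of R^4, with the same fibres: the orbits of [G] acting by
   polynomial maps.  This action is free and properly discontinuous because a
   discrete subgroup is closed.  Smoothness of all the charts involved is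
   then checked in the coordinates of R^4. *)

(** A matrix of [H] acts on [w_1 / w_2] by the real translation of vector [b], so the imaginary part
    is invariant and its logarithm [t] serves as the factor R; on each level set the action of [H]
    is simply transitive. The charts of the quotients are not explicit: an orbit atlas contains
    every chart that inverts the projection on some open set. Smoothness is therefore reduced to a
    condition on a chart [c] read through a parametrization [q]: near a point, [c o q] is smooth and
    has a smooth local right inverse [s]. If [u] and [v] are preimages of [x] and [f x] under
    parametrizations [q] and [q'], and [h] is a lift of [f] to R^n with [h u = v], smooth at [u],
    then [d o f o c^-1] is [(d o q') o h o s] near [c x]. With [f] the identity this gives the
    transition maps; with the bijection induced by equality of fibres it gives both directions of
    the diffeomorphism. The lifts are the elements of [G] acting on R^4. *)

Local Open Scope classical_set_scope.
Local Open Scope ring_scope.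

(** * Pointwise smoothness *)

Section SmoothAt.
Context {R : realType}.
Implicit Types V W : normedModType R.

(* Differentiability is required near [x], and not only at [x], for the
   derivation rules to hold on a neighbourhood of [x]. *)
Fixpoint Ck_at V W (k : nat) (f : V -> W) (x : V) : Prop :=
  if k is k'.+1 then
    (\forall y \near x, differentiable f y) /\
    forall v, Ck_at k' (fun y => 'D_v f y) x
  else {for x, continuous f}.

Definition smooth_at V W (f : V -> W) (x : V) := forall k, Ck_at k f x.

Lemma smooth_at_on m n (U : set 'rV[R]_m) (f : 'rV[R]_m -> 'rV[R]_n) :
  (forall x, U x -> smooth_at f x) -> smooth_on U f.
Proof.
move=> sf k; have {sf} : forall x, U x -> Ck_at k f x by move=> x /sf.
elim: k f => //= k IH f sf; split=> [x /sf[/nbhs_singleton]//|v].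
by apply: IH => x /sf[].
Qed.

(** Near [x] both functions have the same first-order expansion. By uniqueness of the differential,
    ['d g x] is then ['d f x], which is continuous. *)
Lemma near_eq_differentiable V W (f g : V -> W) x :
  {near x, f =1 g} -> differentiable f x -> differentiable g x.
Proof.
move=> fg df.
have fg0 : \forall h \near (0 : V), f (h + x) = g (h + x).
  by move: fg; rewrite (near_shift 0) subr0.
have gE : g \o shift x = cst (g x) + 'd f x +o_ 0 id.
  apply: (eqaddoP _ _ _ _).2 => e e0.
  have := (eqaddoP _ _ _ _).1 (diff_locally df) e e0.
  move: fg0; apply: filterS2 => h /= fgh.
  by rewrite /= !fctE /= fgh (nbhs_singleton fg).
have dgE : 'd g x = 'd f x :> (V -> W).
  by apply: diff_unique gE; exact: diff_continuous.
by apply/diff_locallyP; rewrite dgE; split; first exact: diff_continuous.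
Qed.

(** A formula for a derivative holds only where the functions involved are differentiable, that is,
    near [x]. This lemma lets such a formula replace the derivative in the inductions below. *)
Lemma Ck_at_near_eq V W k (f g : V -> W) x :
  {near x, f =1 g} -> Ck_at k f x -> Ck_at k g x.
Proof.
elim: k f g => /= [f g fg|k IH f g fg [df Df]].
  rewrite /prop_for /continuous_at -(nbhs_singleton fg).
  by apply: cvg_trans; apply: near_eq_cvg.
split.
  (* Passing to the interior makes the equality hold in a neighbourhood of each nearby [y], as
     differentiation at [y] requires. *)
  move: df (nbhs_interior fg); apply: filterS2 => y df fgy.
  exact: near_eq_differentiable df.
move=> v; apply: IH (Df v); move: (nbhs_interior fg); apply: filterS => y fgy.
exact: near_eq_derive.
Qed.

Lemma Ck_at_continuous V W k (f : V -> W) x :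
  Ck_at k f x -> {for x, continuous f}.
Proof.
by case: k => //= k [/nbhs_singleton/differentiable_continuous].
Qed.

(** The Leibniz and chain rules leave undifferentiated factors, given at order [k.+1] but fed to the
    induction hypothesis at order [k]. *)
Lemma Ck_atS V W k (f : V -> W) x : Ck_at k.+1 f x -> Ck_at k f x.
Proof.
elim: k f => [f /Ck_at_continuous//|k IH f [df Df]]; split=> // v.
exact/IH/Df.
Qed.

Lemma smooth_at_near_eq V W (f g : V -> W) x :
  {near x, f =1 g} -> smooth_at f x -> smooth_at g x.
Proof. by move=> fg sf k; apply: Ck_at_near_eq (sf k). Qed.

Lemma smooth_at_continuous V W (f : V -> W) x :
  smooth_at f x -> {for x, continuous f}.
Proof. by move=> /(_ 0). Qed.

Lemma smooth_at_cst V W (c : W) (x : V) : smooth_at (fun=> c) x.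
Proof.
move=> k; elim: k c => [c|k IH c]; first exact: cst_continuous.
split=> [|v]; first by apply: nearW => y; exact: differentiable_cst.
by apply: Ck_at_near_eq (IH 0); apply: nearW => y; rewrite derive_cst.
Qed.

Lemma Ck_atD V W k (f g : V -> W) x :
  Ck_at k f x -> Ck_at k g x -> Ck_at k (fun y => f y + g y) x.
Proof.
elim: k f g => [f g|k IH f g [df Df] [dg Dg]]; first exact: continuousD.
split=> [|v].
  by move: df dg; apply: filterS2 => y; exact: differentiableD.
apply: Ck_at_near_eq (IH _ _ (Df v) (Dg v)).
move: df dg; apply: filterS2 => y df dg.
by rewrite deriveD//; exact: diff_derivable.
Qed.

Lemma Ck_atN V W k (f : V -> W) x : Ck_at k f x -> Ck_at k (fun y => - f y) x.
Proof.
elim: k f => [f|k IH f [df Df]]; first exact: continuousN.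
split=> [|v].
  by move: df; apply: filterS => y; exact: differentiableN.
apply: Ck_at_near_eq (IH _ (Df v)).
by move: df; apply: filterS => y df; rewrite deriveN//; exact: diff_derivable.
Qed.

Lemma Ck_atM V k (f g : V -> R) x :
  Ck_at k f x -> Ck_at k g x -> Ck_at k (fun y => f y * g y) x.
Proof.
elim: k f g => [f g|k IH f g cf cg]; first exact: continuousM.
have [[df Df] [dg Dg]] := (cf, cg).
split=> [|v].
  by move: df dg; apply: filterS2 => y; exact: differentiableM.
have := Ck_atD (IH _ _ (Ck_atS cf) (Dg v)) (IH _ _ (Ck_atS cg) (Df v)).
apply: Ck_at_near_eq; move: df dg; apply: filterS2 => y df dg.
by rewrite deriveM//; exact: diff_derivable.
Qed.

(** The derivative of [1/f] is [- (1/f) (1/f)] times that of [f], and the induction hypothesis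
    covers [1/f] at the lower order. *)
Lemma Ck_atV V k (f : V -> R) x :
  f x != 0 -> Ck_at k f x -> Ck_at k (fun y => (f y)^-1) x.
Proof.
move=> fx0; elim: k => [|k IH cf]; first exact: continuousV.
have [df Df] := cf.
have f0 : \forall y \near x, f y != 0.
  have /= := Ck_at_continuous cf.
  by move=> /(_ [set z | z != 0]); apply; exact: open_nbhs_nbhs.
split=> [|v].
  by move: f0 df; apply: filterS2 => y f0 df; exact: differentiableV.
have cV := IH (Ck_atS cf).
apply: Ck_at_near_eq (Ck_atN (Ck_atM (Ck_atM cV cV) (Df v))).
move: f0 df; apply: filterS2 => y f0 df.
by rewrite deriveV//; [rewrite -exprVn expr2 scaleNr|exact: diff_derivable].
Qed.

End SmoothAt.

(** * Exponential, logarithm and vector-valued maps *)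

Section SmoothComp.
Context {R : realType}.
Implicit Types V W : normedModType R.

Lemma derive_comp1 V (h : R -> R) (f : V -> R) y v :
  differentiable f y -> differentiable h (f y) ->
  'D_v (h \o f) y = 'D_1 h (f y) * 'D_v f y.
Proof.
move=> df dh; have dhv : derivable h (f y) 1 by exact/derivable1_diffP.
rewrite deriveE; last exact: differentiable_comp.
by rewrite (diff_comp df dh) /= deriv1E// derive1E -(deriveE _ df) [LHS]mulrC.
Qed.

Lemma Ck_at_expR V k (f : V -> R) x :
  Ck_at k f x -> Ck_at k (fun y => expR (f y)) x.
Proof.
elim: k => [cf|k IH cf].
  by apply: (continuous_comp cf); exact: continuous_expR.
have [df Df] := cf.
have dexp z : differentiable (expR : R -> R) z.
  by apply/derivable1_diffP; exact: derivable_expR.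
split=> [|v].
  by move: df; apply: filterS => y df; exact: differentiable_comp.
apply: Ck_at_near_eq (Ck_atM (IH (Ck_atS cf)) (Df v)).
move: df; apply: filterS => y df; rewrite derive_comp1//.
by have [_ ->] := is_derive_expR (f y).
Qed.

Lemma Ck_at_ln V k (f : V -> R) x :
  0 < f x -> Ck_at k f x -> Ck_at k (fun y => ln (f y)) x.
Proof.
(* No induction: the derivative of [ln o f] is [1/f] times that of [f], which [Ck_atV] and [Ck_atM]
   already cover. *)
move=> fx0; case: k => [cf|k cf].
  by apply: (continuous_comp cf); exact: continuous_ln.
have f0 : \forall y \near x, 0 < f y.
  have /= := Ck_at_continuous cf.
  by move=> /(_ [set z | 0 < z]); apply; exact: lt_nbhsr.
have [df Df] := cf.
have dln (z : R) : 0 < z -> differentiable (@ln R) z.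
  by move=> z0; apply/derivable1_diffP; have [] := is_derive1_ln z0.
split=> [|v].
  move: f0 df; apply: filterS2 => y f0 df.
  by apply: differentiable_comp => //; exact: dln.
have cV := Ck_atV (lt0r_neq0 fx0) (Ck_atS cf).
apply: Ck_at_near_eq (Ck_atM cV (Df v)).
move: f0 df; apply: filterS2 => y f0 df.
rewrite derive_comp1//; last exact: dln.
by have [_ ->] := is_derive1_ln f0.
Qed.

Lemma differentiable_rV V m (f : V -> 'rV[R]_m) x :
  (forall j, differentiable (fun y => f y 0 j) x) -> differentiable f x.
Proof.
move=> df.
have -> : f = \sum_(j < m) (fun y => f y 0 j *: (delta_mx 0 j : 'rV_m)).
  by apply/funext => y; rewrite fct_sumE [LHS]row_sum_delta.
by apply: differentiable_sum => j; exact: differentiableZl.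
Qed.

Lemma continuous_mx (T S : topologicalType) m n (f : T -> 'M[S]_(m, n)) x :
  (forall i j, {for x, continuous (fun y => f y i j)}) -> {for x, continuous f}.
Proof.
move=> cf A [P fP PA]; rewrite nbhs_simpl /=.
have : \forall y \near x, forall i j, P i j (f y i j).
  by apply: filter_forall => i; apply: filter_forall => j; exact/cf/fP.
by apply: filterS => y fy; exact: PA.
Qed.

Lemma continuous_rV (T S : topologicalType) m (f : T -> 'rV[S]_m) x :
  (forall j, {for x, continuous (fun y => f y 0 j)}) -> {for x, continuous f}.
Proof. by move=> cf; apply: continuous_mx => i j; rewrite (ord1 i). Qed.

Lemma derive_coord V m (f : V -> 'rV[R]_m) x v j :
  differentiable f x -> 'D_v (fun y => f y 0 j) x = ('D_v f x) 0 j.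
Proof. by move=> df; rewrite derive_mx ?mxE//; exact: diff_derivable. Qed.

Lemma differentiable_rV_coord V m (f : V -> 'rV[R]_m) x j :
  differentiable f x -> differentiable (fun y => f y 0 j) x.
Proof.
move=> df; apply: (@differentiable_comp _ _ _ _ f (fun M => M 0 j)) => //.
exact: differentiable_coord.
Qed.

Lemma Ck_at_rV V m k (f : V -> 'rV[R]_m) x :
  (forall j, Ck_at k (fun y => f y 0 j) x) <-> Ck_at k f x.
Proof.
split; elim: k f => [f cf|k IH f cf]; first exact: continuous_rV.
(* There are finitely many coordinates, so one neighbourhood serves them all. *)
- have dfc : \forall y \near x, forall j, differentiable (fun y => f y 0 j) y.
    by apply: filter_forall => j; have [] := cf j.
  have df : \forall y \near x, differentiable f y.
    by move: dfc; apply: filterS => y /differentiable_rV.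
  split=> // v; apply: IH => j; have [_ /(_ v)] := cf j; apply: Ck_at_near_eq.
  by move: df; apply: filterS => y df; rewrite derive_coord.
- move=> j; apply: (@continuous_comp _ _ _ f (fun M => M 0 j)) => //.
  exact: coord_continuous.
- have [df Df] := cf; move=> j; split=> [|v].
    by move: df; apply: filterS => y; exact: differentiable_rV_coord.
  apply: Ck_at_near_eq (IH _ (Df v) j).
  by move: df; apply: filterS => y df; rewrite derive_coord.
Qed.

Lemma smooth_at_rV V m (f : V -> 'rV[R]_m) x :
  (forall j, smooth_at (fun y => f y 0 j) x) <-> smooth_at f x.
Proof.
split=> sf k; first by apply/Ck_at_rV => j; exact: sf.
by move=> k'; move: k; exact/Ck_at_rV.
Qed.

End SmoothComp.

(** * Chain rule and closure properties of smooth maps *)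

Section SmoothAlgebra.
Context {R : realType}.
Implicit Types V W : normedModType R.

Lemma Ck_at_sum V k n (f : 'I_n -> V -> R) x :
  (forall j, Ck_at k (f j) x) -> Ck_at k (fun y => \sum_j f j y) x.
Proof.
move=> cf; elim: n f cf => [f _|n IH f cf].
  have c0 : Ck_at k (fun=> 0 : R) x by exact: smooth_at_cst.
  by apply: Ck_at_near_eq c0; apply: nearW => y; rewrite big_ord0.
apply: Ck_at_near_eq (Ck_atD (IH _ (fun j => cf (widen_ord (leqnSn n) j)))
  (cf ord_max)).
by apply: nearW => y; rewrite big_ord_recr.
Qed.

(** Partial derivatives along the fixed basis vectors keep each ['D_(delta_mx 0 j) f] composed with
    [g] a composition of the same kind, so that induction on the order applies to it. *)
Lemma derive_comp_rV V m (f : 'rV[R]_m -> R) (g : V -> 'rV[R]_m) y v :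
  differentiable g y -> differentiable f (g y) ->
  'D_v (f \o g) y =
  \sum_j 'D_(delta_mx 0 j) f (g y) * 'D_v (fun z => g z 0 j) y.
Proof.
move=> dg df; rewrite deriveE; last exact: differentiable_comp.
rewrite (diff_comp dg df) /= -(deriveE _ dg) [X in 'd f _ X]row_sum_delta.
rewrite linear_sum; apply: eq_bigr => j _.
rewrite linearZ [LHS]mulrC -(deriveE _ df) derive_coord//.
Qed.

Lemma Ck_at_comp V m k (f : 'rV[R]_m -> R) (g : V -> 'rV[R]_m) x :
  Ck_at k g x -> Ck_at k f (g x) -> Ck_at k (f \o g) x.
Proof.
elim: k f => [f|k IH f cg cf]; first exact: continuous_comp.
have [[dg Dg] [df Df]] := (cg, cf).
have dfg : \forall y \near x, differentiable f (g y).
  exact: (Ck_at_continuous cg) df.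
split=> [|v].
  by move: dg dfg; apply: filterS2 => y; exact: differentiable_comp.
have := Ck_at_sum (fun j => Ck_atM (IH _ (Ck_atS cg) (Df (delta_mx 0 j)))
  ((Ck_at_rV _ _ _).2 (Dg v) j)).
apply: Ck_at_near_eq.
move: dg dfg; apply: filterS2 => y dg dfg; rewrite derive_comp_rV//.
by apply: eq_bigr => j _; rewrite derive_coord.
Qed.

Lemma smooth_at_comp V m n (f : 'rV[R]_m -> 'rV[R]_n) (g : V -> 'rV[R]_m) x :
  smooth_at g x -> smooth_at f (g x) -> smooth_at (f \o g) x.
Proof.
move=> sg /smooth_at_rV sf; apply/smooth_at_rV => j k.
exact: (Ck_at_comp (sg k) (sf j k)).
Qed.

Lemma smooth_at_coord m (j : 'I_m) (x : 'rV[R]_m) :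
  smooth_at (fun y : 'rV[R]_m => y 0 j) x.
Proof.
case=> [|k]; first exact: coord_continuous.
split=> [|v].
  by apply: (@nearW _ (nbhs x)) => y; exact: differentiable_coord.
have cv : Ck_at k (fun=> v 0 j) x by exact: smooth_at_cst.
apply: Ck_at_near_eq cv; apply: (@nearW _ (nbhs x)) => y.
by rewrite (derive_coord (f := id))// derive_id.
Qed.

Lemma smooth_atD V W (f g : V -> W) x :
  smooth_at f x -> smooth_at g x -> smooth_at (fun y => f y + g y) x.
Proof. by move=> sf sg k; exact: Ck_atD. Qed.

Lemma smooth_atN V W (f : V -> W) x :
  smooth_at f x -> smooth_at (fun y => - f y) x.
Proof. by move=> sf k; exact: Ck_atN. Qed.

Lemma smooth_atM V (f g : V -> R) x :
  smooth_at f x -> smooth_at g x -> smooth_at (fun y => f y * g y) x.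
Proof. by move=> sf sg k; exact: Ck_atM. Qed.

Lemma smooth_atV V (f : V -> R) x :
  f x != 0 -> smooth_at f x -> smooth_at (fun y => (f y)^-1) x.
Proof. by move=> f0 sf k; exact: Ck_atV. Qed.

Lemma smooth_at_expR V (f : V -> R) x :
  smooth_at f x -> smooth_at (fun y => expR (f y)) x.
Proof. by move=> sf k; exact: Ck_at_expR. Qed.

Lemma smooth_at_ln V (f : V -> R) x :
  0 < f x -> smooth_at f x -> smooth_at (fun y => ln (f y)) x.
Proof. by move=> f0 sf k; exact: Ck_at_ln. Qed.

End SmoothAlgebra.

(** * Manifolds parametrized by an open surjection from R^n *)

Section Parametrization.
Context {R : realType} {n : nat}.
Local Notation E := 'rV[R]_n.

(** Openness makes [X] the topological quotient of R^n by the fibres of [q], so that topological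
    properties of [X] can be tested in R^n. *)
Definition parametrization (X : topologicalType) (q : E -> X) :=
  [/\ continuous q, forall U, open U -> open (q @` U)
    & forall x, exists u, q u = x].

(* The local section [s] of [q] is part of the definition because the inverse
   function theorem is not available to deduce its smoothness from that of
   [c \o q]. *)
Definition adapted (X : topologicalType) m (q : E -> X)
    (c : chart (R := R) X m) :=
  [/\ open (chart_dom c), {in chart_dom c &, injective c}
    & forall x, chart_dom c x -> exists u (s : 'rV[R]_m -> E),
      [/\ q u = x, smooth_at (c \o q) u, smooth_at s (c x), s (c x) = u
        & \forall y \near c x, c (q (s y)) = y]].

Lemma second_countable_rV : @second_countable E.
Proof.
pose B (p : 'rV[rat]_n * nat) : set E :=
  ball (\row_j ratr (p.1 0 j) : E) (p.2.+1%:R^-1).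
exists (range B); first exact: sub_countable (card_image_le _ _) _.
split=> [_ [p _ <-]|x A /nbhs_ballP[e /= e0 xeA]]; first exact: ball_open.
(* A basic ball of this radius that contains [x] lies in the ball of radius [e] about [x]: two radii
   are spent in the triangle inequality. *)
have [k ke] : exists k : nat, k.+1%:R^-1 < e / 2.
  have e2 : 0 < e / 2 by rewrite divr_gt0.
  by have [N _ /(_ N (leqnn N))] := near_infty_natSinv_lt (PosNum e2); exists N.
have ratx j : exists r : rat, ball (x 0 j) k.+1%:R^-1 (ratr r).
  have k0 : 0 < k.+1%:R^-1 :> R by rewrite invr_gt0 ltr0n.
  have /rat_in_itvoo[r] : x 0 j - k.+1%:R^-1 < x 0 j by rewrite ltrBlDr ltrDl.
  rewrite in_itv/= => /andP[r1 r2]; exists r.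
  by rewrite -ball_normE/= ger0_norm ?subr_ge0 ?ltW// ltrBlDr -ltrBlDl.
have [p px] := choice ratx.
exists (B (\row_j p j, k)); first split.
- by exists (\row_j p j, k).
- apply: ball_sym; split=> [|i j]; first by rewrite invr_gt0 ltr0n.
  by rewrite !mxE (ord1 i); exact: px.
- move=> y By; apply: xeA; apply: (@le_ball _ _ _ (k.+1%:R^-1 + k.+1%:R^-1)).
    by rewrite [leRHS]splitr lerD// ltW.
  apply: ball_triangle By; split=> [|i j]; first by rewrite invr_gt0 ltr0n.
  by rewrite !mxE (ord1 i); exact: px.
Qed.

Lemma parametrization_second_countable (X : topologicalType) (q : E -> X) :
  parametrization q -> @second_countable X.
Proof.
move=> [cq oq sq]; have [B cB [Bo Bb]] := second_countable_rV.
exists [set q @` U | U in B]; first exact: sub_countable (card_image_le _ _) cB.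
split=> [_ [U BU <-]|x A xA]; first exact/oq/Bo.
have [u ux] := sq x.
have : nbhs u (q @^-1` A) by apply: cq; rewrite ux.
move=> /Bb[U [BU Uu] UA]; exists (q @` U); first split.
- by exists U.
- by exists u.
- by move=> _ [z /UA Az <-].
Qed.

(** The hypothesis says that the complement of the fibre relation is open. A product neighbourhood
    contained in it has two factors whose images under the open map [q] are disjoint. *)
Lemma parametrization_hausdorff (X : topologicalType) (q : E -> X) :
  parametrization q ->
  (forall u v, q u <> q v -> \forall p \near (u, v), q p.1 <> q p.2) ->
  hausdorff_space X.
Proof.
move=> [cq oq sq] sep; rewrite open_hausdorff => x y /eqP.
have [u <-] := sq x; have [v <-] := sq y.
move=> /sep[[U V] [/= nU nV] UV].
exists (q @` U°, q @` V°); split => /=.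
- by rewrite inE; exists u.
- by rewrite inE; exists v.
- exact/oq/open_interior.
- exact/oq/open_interior.
- apply/eqP/seteqP; split=> // _ [[u' Uu' <-] [v' Vv' uv]].
  by apply: (UV (u', v')) => //; split; exact: interior_subset.
Qed.

Lemma adapted_is_chart (X : topologicalType) m (q : E -> X) (c : chart X m) :
  parametrization q -> adapted q c -> is_chart c.
Proof.
move=> [cq oq _] [oc ic ac]; split=> // A Ac; split.
(* Openness of the image comes from the section: [y] near [c x] is the value of [c] at [q (s y)], a
   point of [A]. *)
- move=> oA; rewrite openE => _ [x Ax <-].
  have [u [s [ux _ ss su sK]]] := ac _ (Ac _ Ax).
  have : \forall y \near c x, A (q (s y)).
    have : {for c x, continuous (q \o s)}.
      by apply: continuous_comp; [exact: smooth_at_continuous|exact: cq].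
    by apply; rewrite /= su ux; exact: open_nbhs_nbhs.
  by rewrite /interior; move: sK; apply: filterS2 => y cy Ay; exists (q (s y)).
- move=> ocA; rewrite openE => x Ax.
  have [u [s [ux sq _ _ _]]] := ac _ (Ac _ Ax).
  have cu : \forall z \near u, (c @` A) (c (q z)).
    apply: (smooth_at_continuous sq); rewrite /= ux.
    by apply: open_nbhs_nbhs; split=> //; exists x.
  have du : \forall z \near u, chart_dom c (q z).
    by apply: cq; rewrite ux; apply: open_nbhs_nbhs; split=> //; exact: Ac.
  (* Some point of [A] has the same value under [c] as [q z]; injectivity of [c] identifies the
     two. *)
  have Au : \forall z \near u, A (q z).
    move: cu du; apply: filterS2 => z [a Aa ca] dz.
    by rewrite -(ic a (q z)) ?inE//; exact: Ac.
  have qAx : open_nbhs x (q @` (q @^-1` A)°).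
    by split; [exact/oq/open_interior|exists u].
  rewrite /interior nbhsE; exists (q @` (q @^-1` A)°) => //.
  by move=> _ [z /interior_subset Az <-].
Qed.

(** Lifts of [f] to R^n with a prescribed value. The value [v] must be arbitrary because a chart
    adapted at [f x] comes with its own preimage of [f x]. For [f] the identity these lifts are deck
    transformations. *)
Definition deck_linked (X Y : topologicalType) (qX : E -> X) (qY : E -> Y)
    (f : X -> Y) :=
  forall u v, f (qX u) = qY v -> exists h : E -> E,
    [/\ h u = v, smooth_at h u & forall z, f (qX z) = qY (h z)].

Lemma coordinate_expression_smooth (X Y : topologicalType) m p
    (qX : E -> X) (qY : E -> Y) (f : X -> Y) (c : chart X m) (d : chart Y p) :
  continuous qX -> adapted qX c -> adapted qY d -> deck_linked qX qY f ->
  exists g : 'rV[R]_m -> 'rV[R]_p,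
    smooth_on (c @` (chart_dom c `&` f @^-1` chart_dom d)) g /\
    forall x, chart_dom c x -> chart_dom d (f x) -> g (c x) = d (f x).
Proof.
move=> cqX [oc ic ac] [od _ ad] link.
(* The value is 0 off the image of [c]; on the image, injectivity of [c] makes it unique. *)
pose g y := xget 0
  [set z | exists x, [/\ chart_dom c x, c x = y & z = d (f x)]].
have gE x : chart_dom c x -> g (c x) = d (f x).
  move=> cx; apply: xget_unique; first by exists x.
  by move=> _ [x' [cx' xE ->]]; rewrite (ic x' x)// inE.
exists g; split=> [|x cx _]; last exact: gE.
apply: smooth_at_on => _ [x [cx dfx] <-].
have [u [s [ux _ ss su sK]]] := ac _ cx.
have [v [_ [vy sdq _ _ _]]] := ad _ dfx.
have [|h [hu sh hq]] := link u v; first by rewrite ux vy.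
have shs : smooth_at (h \o s) (c x) by apply: smooth_at_comp; rewrite ?su.
have sdhs : smooth_at ((d \o qY) \o (h \o s)) (c x).
  by apply: smooth_at_comp; rewrite //= su hu.
apply: smooth_at_near_eq sdhs.
have cqs : \forall y \near c x, chart_dom c (qX (s y)).
  have : {for c x, continuous (qX \o s)}.
    by apply: continuous_comp; [exact: smooth_at_continuous|exact: cqX].
  by apply; rewrite /= su ux; exact: open_nbhs_nbhs.
move: cqs sK; apply: filterS2 => y cy yE.
by rewrite -[in RHS]yE gE//= hq.
Qed.

Lemma parametrization_continuous (X Y : topologicalType) (qX : E -> X)
    (qY : E -> Y) (f : X -> Y) :
  parametrization qX -> parametrization qY ->
  (forall u, f (qX u) = qY u) -> continuous f.
Proof.
move=> [cX oX sX] [cY oY sY] fq x A.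
have [u <-] := sX x; rewrite fq => /cY; rewrite /= => uA.
rewrite nbhs_simpl nbhsE; exists (qX @` (qY @^-1` A)°).
  by split; [exact/oX/open_interior|exists u].
by move=> _ [z /interior_subset Az <-]; rewrite /= fq.
Qed.

Lemma adapted_smooth_atlas (X : topologicalType) m (q : E -> X)
    (A : set (chart X m)) :
  parametrization q ->
  (forall u v, q u <> q v -> \forall p \near (u, v), q p.1 <> q p.2) ->
  deck_linked q q id ->
  (forall c, A c -> adapted q c) ->
  (forall x, exists2 c, A c & chart_dom c x) -> smooth_atlas A.
Proof.
move=> pq sep link aA covA; split=> //.
- exact: parametrization_hausdorff sep.
- exact: parametrization_second_countable pq.
- by move=> c /aA; exact: adapted_is_chart.
- move=> c d /aA ac /aA ad.
  by have [cq _ _] := pq; have := coordinate_expression_smooth cq ac ad link.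
Qed.

(** Deck transformations and separation are asked of [qX] alone: they depend only on the fibres,
    which [qY] shares. *)
Lemma diffeomorphic_parametrization (X Y : topologicalType) m p
    (qX : E -> X) (qY : E -> Y) (A : set (chart X m)) (B : set (chart Y p)) :
  parametrization qX -> parametrization qY ->
  (forall u v, qX u = qX v <-> qY u = qY v) ->
  (forall u v, qX u = qX v -> exists h : E -> E,
    [/\ h u = v, smooth_at h u & forall z, qX z = qX (h z)]) ->
  (forall u v, qX u <> qX v -> \forall z \near (u, v), qX z.1 <> qX z.2) ->
  (forall c, A c -> adapted qX c) ->
  (forall x, exists2 c, A c & chart_dom c x) ->
  (forall c, B c -> adapted qY c) ->
  (forall y, exists2 c, B c & chart_dom c y) ->
  diffeomorphic A B.
Proof.
move=> pX pY eqXY deck sep aA covA aB covB.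
have [[cX _ sX] [cY _ sY]] := (pX, pY).
have [rX rXK] := choice sX; have [rY rYK] := choice sY.
(* The chosen preimages [rX] and [rY] may be discontinuous, but equality of the fibres makes [f] and
   [g] independent of them. *)
pose f x := qY (rX x); pose g y := qX (rY y).
have fE u : f (qX u) = qY u by apply/eqXY; rewrite rXK.
have gE u : g (qY u) = qX u by apply/eqXY; rewrite rYK.
have linkXX : deck_linked qX qX id by exact: deck.
have linkXY : deck_linked qX qY f.
  move=> u v; rewrite fE => /eqXY/deck[h [hu sh hq]]; exists h; split=> // z.
  by rewrite fE; apply/eqXY.
have linkYX : deck_linked qY qX g.
  move=> u v; rewrite gE => /deck[h [hu sh hq]]; exists h; split=> // z.
  by rewrite gE.
have linkYY : deck_linked qY qY id.
  move=> u v /eqXY/deck[h [hu sh hq]]; exists h; split=> // z.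
  exact/eqXY.
split.
- exact: adapted_smooth_atlas aA covA.
- apply: adapted_smooth_atlas aB covB => // u v uv.
  have /sep : qX u <> qX v by move/eqXY.
  by apply: filterS => z nz /eqXY.
- exists f, g; split.
  + by move=> x; have [u <-] := sX x; rewrite fE gE.
  + by move=> y; have [u <-] := sY y; rewrite gE fE.
  + split; first exact: (parametrization_continuous pX pY fE).
    by move=> c d /aA ac /aB ad; exact: coordinate_expression_smooth linkXY.
  + split; first exact: (parametrization_continuous pY pX gE).
    by move=> c d /aB ac /aA ad; exact: coordinate_expression_smooth linkYX.
Qed.

End Parametrization.

(** * The Heisenberg group and its discrete subgroups *)

Section HeisCoordinates.
Context {R : realType}.
Implicit Types g h k : heis R.

Definition ha h : R := heis_val h 0 1.
Definition hb h : R := heis_val h 1 2%:R.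
Definition hc h : R := heis_val h 0 2%:R.

Lemma heis_mx_in (a b c : R) : heis_mx a b c \in heis_set.
Proof. by rewrite inE; exists a, b, c. Qed.

Definition mkheis (a b c : R) : heis R :=
  exist _ (heis_mx a b c) (heis_mx_in a b c).

Lemma ha_mk a b c : ha (mkheis a b c) = a.
Proof. by rewrite /ha /heis_val /= mxE. Qed.

Lemma hb_mk a b c : hb (mkheis a b c) = b.
Proof. by rewrite /hb /heis_val /= mxE. Qed.

Lemma hc_mk a b c : hc (mkheis a b c) = c.
Proof. by rewrite /hc /heis_val /= mxE. Qed.

Lemma heis_eta h : h = mkheis (ha h) (hb h) (hc h).
Proof.
have := valP h; rewrite inE => -[a [b [c hE]]].
have -> : h = mkheis a b c by apply/val_inj.
by rewrite ha_mk hb_mk hc_mk.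
Qed.

Lemma mkheisM a b c a' b' c' :
  (mkheis a b c * mkheis a' b' c')%g =
  mkheis (a + a') (b + b') (c + a * b' + c').
Proof. by apply/val_inj; exact: heis_mxM. Qed.

Lemma mkheisV a b c : ((mkheis a b c)^-1)%g = mkheis (- a) (- b) (a * b - c).
Proof. by apply/val_inj; exact: heis_mxV. Qed.

Lemma continuous_heis_val : continuous (@heis_val R).
Proof. exact: initial_continuous. Qed.

Lemma continuous_ha : continuous ha.
Proof.
move=> h; apply: (@continuous_comp _ _ _ (@heis_val R) (fun M => M 0 1)).
  exact: continuous_heis_val.
exact: coord_continuous.
Qed.

Lemma continuous_hb : continuous hb.
Proof.
move=> h; apply: (@continuous_comp _ _ _ (@heis_val R) (fun M => M 1 2%:R)).
  exact: continuous_heis_val.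
exact: coord_continuous.
Qed.

Lemma continuous_hc : continuous hc.
Proof.
move=> h; apply: (@continuous_comp _ _ _ (@heis_val R) (fun M => M 0 2%:R)).
  exact: continuous_heis_val.
exact: coord_continuous.
Qed.

Lemma continuous_set_type (T S : topologicalType) (A : set S)
    (f : T -> set_type A) x :
  {for x, continuous (fun y => set_val (f y))} -> {for x, continuous f}.
Proof.
move=> cf U [_ [[W oW <-] /= Wfx WU]]; rewrite nbhs_simpl /=.
have : \forall y \near x, W (set_val (f y)) by apply: cf; exact: open_nbhs_nbhs.
by apply: filterS => y /WU.
Qed.

Lemma continuous_mkheis (T : topologicalType) (a b c : T -> R) x :
  {for x, continuous a} -> {for x, continuous b} -> {for x, continuous c} ->
  {for x, continuous (fun y => mkheis (a y) (b y) (c y))}.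
Proof.
move=> ca cb cc; apply: continuous_set_type; apply: continuous_mx => i j.
have -> : (fun y => set_val (mkheis (a y) (b y) (c y)) i j) =
  (fun y => heis_mx (a y) (b y) (c y) i j) by [].
have cE (f f' : T -> R) :
    {for x, continuous f} -> f' =1 f -> {for x, continuous f'}.
  by move=> cf /funext->.
have c0 (r : R) : {for x, continuous (fun=> r)} by exact: cst_continuous.
case: i => [[|[|[|//]]] ?]; case: j => [[|[|[|//]]] ?];
  [apply: (cE _ _ (c0 1))|apply: (cE _ _ ca)|apply: (cE _ _ cc)
  |apply: (cE _ _ (c0 0))|apply: (cE _ _ (c0 1))|apply: (cE _ _ cb)
  |apply: (cE _ _ (c0 0))|apply: (cE _ _ (c0 0))|apply: (cE _ _ (c0 1))];
  by move=> y; rewrite mxE.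
Qed.

Lemma continuous_heis_div :
  continuous (fun p : heis R * heis R => (p.1 * p.2^-1)%g).
Proof.
have -> : (fun p : heis R * heis R => (p.1 * p.2^-1)%g) =
  (fun p => mkheis (ha p.1 - ha p.2) (hb p.1 - hb p.2)
     (hc p.1 - ha p.1 * hb p.2 + (ha p.2 * hb p.2 - hc p.2))).
  apply/funext => -[g h] /=; rewrite [g]heis_eta [h]heis_eta.
  by rewrite mkheisV mkheisM !(ha_mk, hb_mk, hc_mk) mulrN.
move=> p.
have c1 (f : heis R -> R) : continuous f ->
    {for p, continuous (fun q : heis R * heis R => f q.1)}.
  by move=> cf; apply: continuous_comp; [exact: cvg_fst|exact: cf].
have c2 (f : heis R -> R) : continuous f ->
    {for p, continuous (fun q : heis R * heis R => f q.2)}.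
  by move=> cf; apply: continuous_comp; [exact: cvg_snd|exact: cf].
have [[a1 b1] [[d1 a2] [b2 d2]]] := (c1 _ continuous_ha, c1 _ continuous_hb,
  (c1 _ continuous_hc, c2 _ continuous_ha,
  (c2 _ continuous_hb, c2 _ continuous_hc))).
apply: (@continuous_mkheis _ (fun p => ha p.1 - ha p.2)
    (fun p => hb p.1 - hb p.2)
    (fun p => hc p.1 - ha p.1 * hb p.2 + (ha p.2 * hb p.2 - hc p.2)) p).
- exact: continuousB.
- exact: continuousB.
- by apply: continuousD; apply: continuousB => //; exact: continuousM.
Qed.

Lemma continuous_heis_mull g : continuous (fun h => (g * h)%g).
Proof.
have -> : (fun h => (g * h)%g) = (fun h => mkheis (ha g + ha h) (hb g + hb h)
     (hc g + ha g * hb h + hc h)).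
  apply/funext => h /=; rewrite [in LHS](heis_eta g) [in LHS](heis_eta h).
  by rewrite mkheisM.
move=> h.
have [[a b] d] := (@continuous_ha h, @continuous_hb h, @continuous_hc h).
apply: (@continuous_mkheis _ (fun h => ha g + ha h)
    (fun h => hb g + hb h) (fun h => hc g + ha g * hb h + hc h) h).
- by apply: continuousD => //; exact: cst_continuous.
- by apply: continuousD => //; exact: cst_continuous.
- apply: continuousD => //; apply: continuousD; first exact: cst_continuous.
  by apply: continuousM => //; exact: cst_continuous.
Qed.

End HeisCoordinates.

(** * Discrete subgroups of the Heisenberg group and their orbits *)

Section DiscreteSubgroup.
Context {R : realType} (G : set (heis R)).
Implicit Types g h k x y : heis R.
Hypotheses (gG : group_closed [in G]) (dG : G `<=` isolated G).
Local Open Scope group_scope.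

Lemma subgroup1 : G 1.
Proof. by have [/set_mem] := gG. Qed.

Lemma subgroup_div g h : G g -> G h -> G (g * h^-1).
Proof. by case: gG => _ dvG Gg Gh; apply/set_mem/dvG; exact/mem_set. Qed.

Lemma subgroupV g : G g -> G g^-1.
Proof. by move=> /(subgroup_div subgroup1); rewrite mul1g. Qed.

Lemma subgroupM g h : G g -> G h -> G (g * h).
Proof. by move=> Gg /subgroupV/(subgroup_div Gg); rewrite invgK. Qed.

(** Division is continuous, so quotients of points close to [h] fall in a neighbourhood of 1 that
    meets [G] only in 1. This gives both the local injectivity of the projection and the closedness
    of [G]. *)
Lemma discrete_div_eq h :
  \forall p \near (h, h), G (p.1 * p.2^-1) -> p.1 = p.2.
Proof.
have [_ [V V1 VG]] := dG subgroup1.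
have : \forall p \near (h, h), V (p.1 * p.2^-1).
  by apply: (@continuous_heis_div R (h, h)); rewrite /= mulgV.
apply: filterS => -[x y] /= Vxy Gxy.
have : [set 1] (x * y^-1) by rewrite -VG.
by move=> /= /(congr1 (fun z => z * y)); rewrite mulgVK mul1g.
Qed.

(** Two elements of [G] have their quotient in [G], so by [discrete_div_eq] a small neighbourhood of
    [x] contains at most one of them. That one differs from [x], and a smaller neighbourhood avoids
    it. *)
Lemma discrete_closed x : ~ G x -> \forall y \near x, ~ G y.
Proof.
move=> nGx.
have [[U V] [/= Ux Vx] UV] := discrete_div_eq x.
have [[g [Gg Ug Vg]]|nG] := pselect (exists g, [/\ G g, U g & V g]); last first.
  have : nbhs x (U `&` V) by exact: filterI.
  by apply: filterS => y [Uy Vy] Gy; apply: nG; exists y.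
have xg : \forall y \near x, y <> g.
  have xg : heis_val x <> heis_val g.
    by move=> /val_inj xg; apply: nGx; rewrite xg.
  have cg : closed [set heis_val g].
    exact/accessible_closed_set1/hausdorff_accessible/norm_hausdorff.
  have : \forall y \near x, (~` [set heis_val g]) (heis_val y).
    apply: (@continuous_heis_val R x); apply: open_nbhs_nbhs.
    by split=> //; exact: closed_openC.
  by apply: filterS => y /= yg yE; apply: yg; rewrite yE.
move: Ux xg; apply: filterS2 => y Uy yg Gy; apply: yg.
by apply: (UV (y, g)) => //=; exact: subgroup_div.
Qed.

(** The orbit relation is closed in [H x H], which is what a Hausdorff quotient requires. *)
Lemma discrete_div_closed h k :
  ~ G (k * h^-1) -> \forall p \near (h, k), ~ G (p.2 * p.1^-1).
Proof.
move=> /discrete_closed nG.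
have := @continuous_heis_div R (k, h) _ nG => -[[U V] [/= Uk Vh] UV].
by exists (V, U) => //= -[x y] [/= Vx Uy]; exact: (UV (y, x)).
Qed.

Lemma heis_orbitP h k :
  heis_orbit G h = heis_orbit G k <-> G (k * h^-1).
Proof.
split=> [hk|Gkh].
  have : heis_orbit G h k.
    by rewrite hk; exists 1; [exact: subgroup1|rewrite mul1g].
  by move=> [g Gg <-]; rewrite mulgK.
apply/seteqP; split=> _ [g Gg <-].
- exists (g * (k * h^-1)^-1); first by exact: subgroup_div.
  by rewrite invgF -mulgA mulgVK.
- exists (g * (k * h^-1)); first exact: subgroupM.
  by rewrite -mulgA mulgVK.
Qed.

Lemma heis_orbit_proj_open (U : set (heis R)) :
  open U -> open (orbit_proj (heis_orbit G) @` U).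
Proof.
move=> oU; rewrite orbit_openE openE => h [k Uk /orbit_projP/heis_orbitP Ghk].
(* The translation by the inverse of [h k^-1], an element of [G], carries [h] to [k], hence points
   near [h] into [U]. *)
have : \forall h' \near h, U ((h * k^-1)^-1 * h').
  apply: continuous_heis_mull; rewrite invgF mulgVK.
  exact: open_nbhs_nbhs.
apply: filterS => h' Uh'; exists ((h * k^-1)^-1 * h') => //.
by apply/esym/orbit_projP/heis_orbitP; rewrite mulgK; exact: subgroupV.
Qed.

End DiscreteSubgroup.

(** * Existence of charts on an orbit space *)

Section OrbitAtlas.
Context {R : realType} {S : topologicalType} {T : Type} (orb : S -> set T).
Context {n : nat} (A : set (chart (R := R) S n)).

Lemma orbit_atlas_cover c x (W : set S) :
  A c -> open (chart_dom c) -> chart_dom c x -> open W -> W x ->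
  {in W &, injective (orbit_proj orb)} ->
  exists2 e, orbit_atlas orb A e & chart_dom e (orbit_proj orb x).
Proof.
move=> Ac oc cx oW Wx iW; pose W' := W `&` chart_dom c.
(* On the image of [W'] the preimage is unique; elsewhere [inv] takes the default value [x]. *)
pose inv p := xget x [set y | W' y /\ orbit_proj orb y = p].
exists (Chart (orbit_proj orb @` W') (c \o inv)); last by exists x.
exists c, W'; split => //; first exact: openI.
- by move=> y [].
- by move=> y z /set_mem[Wy _] /set_mem[Wz _]; apply: iW; exact/mem_set.
- split=> // y W'y /=; congr (c _); apply: xget_unique => // z [[Wz _]].
  by apply: iW; apply/mem_set => //; case: W'y.
Qed.

End OrbitAtlas.

(** * Left multiplication on H x R in the coordinates of R^4 *)

Section HeisParametrization.
Context {R : realType}.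
Implicit Types u v z : 'rV[R]_4.

Definition mk4 (a b c t : R) : 'rV[R]_4 :=
  \row_(k < 4) nth 0 [:: a; b; c; t] k.

Definition hpart u : heis R := mkheis (u 0 0) (u 0 1) (u 0 2%:R).

Lemma mk4_0 a b c t : mk4 a b c t 0 0 = a. Proof. by rewrite mxE. Qed.
Lemma mk4_1 a b c t : mk4 a b c t 0 1 = b. Proof. by rewrite mxE. Qed.
Lemma mk4_2 a b c t : mk4 a b c t 0 2%:R = c. Proof. by rewrite mxE. Qed.
Lemma mk4_3 a b c t : mk4 a b c t 0 3%:R = t. Proof. by rewrite mxE. Qed.
Definition mk4E := (mk4_0, mk4_1, mk4_2, mk4_3).

Lemma mk4_eta u : u = mk4 (u 0 0) (u 0 1) (u 0 2%:R) (u 0 3%:R).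
Proof.
by apply/rowP => -[[|[|[|[|//]]]] ki]; rewrite mxE /=; congr (u 0 _);
  exact/val_inj.
Qed.

Lemma hpart_mk4 h t : hpart (mk4 (ha h) (hb h) (hc h) t) = h.
Proof. by rewrite /hpart !mk4E -heis_eta. Qed.

Lemma hpart_inj u v : hpart u = hpart v -> u 0 3%:R = v 0 3%:R -> u = v.
Proof.
move=> huv t; rewrite (mk4_eta u) (mk4_eta v) t.
have := congr1 ha huv; rewrite !ha_mk => ->.
have := congr1 hb huv; rewrite !hb_mk => ->.
by have := congr1 hc huv; rewrite !hc_mk => ->.
Qed.

Lemma continuous_hpart : continuous hpart.
Proof.
by move=> u; apply: (@continuous_mkheis _ _ (fun u => u 0 0)
  (fun u => u 0 1) (fun u => u 0 2%:R)); exact: coord_continuous.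
Qed.

Lemma continuous_mk4 (T : topologicalType) (a b c t : T -> R) x :
  {for x, continuous a} -> {for x, continuous b} -> {for x, continuous c} ->
  {for x, continuous t} ->
  {for x, continuous (fun y => mk4 (a y) (b y) (c y) (t y))}.
Proof.
move=> ca cb cc ct.
have cE (f f' : T -> R) :
    {for x, continuous f} -> f' =1 f -> {for x, continuous f'}.
  by move=> cf /funext->.
apply: continuous_rV => -[[|[|[|[|//]]]] ?];
  [apply: (cE _ _ ca)|apply: (cE _ _ cb)|apply: (cE _ _ cc)|apply: (cE _ _ ct)];
  by move=> y; rewrite mxE.
Qed.

Lemma smooth_at_mk4 (V : normedModType R) (a b c t : V -> R) x :
  smooth_at a x -> smooth_at b x -> smooth_at c x -> smooth_at t x ->
  smooth_at (fun y => mk4 (a y) (b y) (c y) (t y)) x.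
Proof.
move=> ca cb cc ct.
have cE (f f' : V -> R) : smooth_at f x -> f' =1 f -> smooth_at f' x.
  by move=> cf /funext->.
apply/smooth_at_rV => -[[|[|[|[|//]]]] ?];
  [apply: (cE _ _ ca)|apply: (cE _ _ cb)|apply: (cE _ _ cc)|apply: (cE _ _ ct)];
  by move=> y; rewrite mxE.
Qed.

Definition act (g : heis R) u : 'rV[R]_4 :=
  mk4 (ha g + u 0 0) (hb g + u 0 1) (hc g + ha g * u 0 1 + u 0 2%:R)
    (u 0 3%:R).

Lemma hpart_act g u : hpart (act g u) = (g * hpart u)%g.
Proof. by rewrite [in RHS](heis_eta g) mkheisM /hpart !mk4E. Qed.

Lemma act_div u v : u 0 3%:R = v 0 3%:R ->
  act (hpart v * (hpart u)^-1)%g u = v.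
Proof.
move=> uv; apply: hpart_inj; last by rewrite mk4_3.
by rewrite hpart_act mulgVK.
Qed.

Lemma smooth_act g u : smooth_at (act g) u.
Proof.
apply: smooth_at_mk4.
- by apply: smooth_atD; [exact: smooth_at_cst|exact: smooth_at_coord].
- by apply: smooth_atD; [exact: smooth_at_cst|exact: smooth_at_coord].
- apply: smooth_atD; last exact: smooth_at_coord.
  apply: smooth_atD; first exact: smooth_at_cst.
  by apply: smooth_atM; [exact: smooth_at_cst|exact: smooth_at_coord].
- exact: smooth_at_coord.
Qed.

Lemma continuous_act g : continuous (act g).
Proof. by move=> u; exact/smooth_at_continuous/smooth_act. Qed.

End HeisParametrization.

(** * (H / G) x R as a quotient of R^4 *)

Section HeisQuotient.
Context {R : realType} (G : set (heis R)).
Hypotheses (gG : group_closed [in G]) (dG : G `<=` isolated G).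
Local Notation E := 'rV[R]_4.
Local Notation projH := (orbit_proj (heis_orbit G)).

(** The common fibre relation of both parametrizations. The division form is suited to the
    closedness of [G]; [act_relP] gives the form by orbits. *)
Definition act_rel (u v : E) : Prop :=
  G (hpart v * (hpart u)^-1)%g /\ u 0 3%:R = v 0 3%:R.

Lemma act_relP u v : act_rel u v <-> exists2 g, G g & act g u = v.
Proof.
split=> [[Gvu uv]|[g Gg <-]].
  by exists (hpart v * (hpart u)^-1)%g => //; exact: act_div.
by split; rewrite ?hpart_act ?mulgK// mk4_3.
Qed.

Lemma act_rel_act g u : G g -> act_rel u (act g u).
Proof. by move=> Gg; apply/act_relP; exists g. Qed.

(** Different values of [t] stay different nearby; for equal values the quotient of the Heisenberg
    parts avoids [G], which [discrete_div_closed] makes an open condition. *)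
Lemma act_rel_sep u v : ~ act_rel u v ->
  \forall z \near (u, v), ~ act_rel z.1 z.2.
Proof.
have [uv|uv] := eqVneq (u 0 3%:R) (v 0 3%:R); last first.
  move=> _.
  have : \forall z \near (u, v), (z.1 : E) 0 3%:R - (z.2 : E) 0 3%:R != 0.
    have c1 (f : E -> R) : continuous f -> continuous (fun z : E * E => f z.1).
      by move=> cf z; apply: continuous_comp; [exact: cvg_fst|exact: cf].
    have c2 (f : E -> R) : continuous f -> continuous (fun z : E * E => f z.2).
      by move=> cf z; apply: continuous_comp; [exact: cvg_snd|exact: cf].
    have c3 : continuous (fun w : E => w 0 3%:R) by exact: coord_continuous.
    have cd := continuousB (c1 _ c3 (u, v)) (c2 _ c3 (u, v)).
    apply: (cd [set r | r != 0]); apply: open_nbhs_nbhs; split=> //=.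
    by rewrite subr_eq0.
  by apply: filterS => -[z w] /=; rewrite subr_eq0 => zw [_ /eqP]; apply/negP.
move=> nuv; have nG : ~ G (hpart v * (hpart u)^-1)%g by move=> Guv; apply: nuv.
have [[U V] [/= Uu Vv] UV] := discrete_div_closed gG dG nG.
exists (hpart @^-1` U, hpart @^-1` V) => /=.
  by split; exact: continuous_hpart.
by move=> -[z w] [/= Uz Vw] [Gwz _]; exact: (UV (hpart z, hpart w)).
Qed.

Lemma heis_proj_locally_injective (h : heis R) :
  exists W, [/\ open W, W h & {in W &, injective projH}].
Proof.
have [[U V] [/= Uh Vh] UV] := discrete_div_eq gG dG h.
(* The intersection allows either point of a pair to be taken in [U] and the other in [V]. *)
exists (U `&` V)°; split; first exact: open_interior.
  exact: filterI.
move=> x y /set_mem/interior_subset[Ux Vx] /set_mem/interior_subset[Uy Vy].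
by move=> /orbit_projP/(heis_orbitP gG) Gyx; apply/esym/(UV (y, x)).
Qed.

Definition heis_param (u : E) : heis_quotient G * R :=
  (projH (hpart u), u 0 3%:R).

Lemma heis_paramP u v : heis_param u = heis_param v <-> act_rel u v.
Proof.
split=> [[/orbit_projP/(heis_orbitP gG) Guv uv] //|].
by move=> [/(heis_orbitP gG)/orbit_projP]; rewrite /heis_param => -> ->.
Qed.

Lemma mk4_hpart (u : E) :
  mk4 (ha (hpart u)) (hb (hpart u)) (hc (hpart u)) (u 0 3%:R) = u.
Proof. by rewrite !(ha_mk, hb_mk, hc_mk) -mk4_eta. Qed.

Lemma continuous_heis_param : continuous heis_param.
Proof.
move=> u A [[U V] [/= nU nV] UV].
have nU' : \forall z \near u, U (projH (hpart z)).
  have hU : nbhs (hpart u) (projH @^-1` U) by exact: pi_continuous nU.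
  exact: continuous_hpart hU.
have nV' : \forall z \near u, V ((z : E) 0 3%:R).
  exact: coord_continuous nV.
by rewrite nbhs_simpl /=; move: nU' nV'; apply: filterS2 => z Uz Vz; exact: UV.
Qed.

Lemma heis_param_parametrization : parametrization heis_param.
Proof.
split; first exact: continuous_heis_param.
- move=> U oU; rewrite openE => _ [u Uu <-].
  (* Continuity of the inverse of the coordinates R^4 -> H x R: it provides a box inside [U], whose
     image contains the product of an open set of orbits and a neighbourhood of [t]. *)
  have cm : {for (hpart u, u 0 3%:R), continuous (fun z : heis R * R =>
      mk4 (ha z.1) (hb z.1) (hc z.1) z.2)}.
    have c1 (f : heis R -> R) : continuous f ->
        continuous (fun z : heis R * R => f z.1).
      by move=> cf z; apply: continuous_comp; [exact: cvg_fst|exact: cf].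
    apply: continuous_mk4; last exact: cvg_snd.
    + exact/c1/continuous_ha.
    + exact/c1/continuous_hb.
    + exact/c1/continuous_hc.
  have : \forall z \near (hpart u, u 0 3%:R),
      U (mk4 (ha z.1) (hb z.1) (hc z.1) z.2).
    by apply: cm; rewrite /= mk4_hpart; exact: open_nbhs_nbhs.
  move=> [[V W] [/= Vu Wu] VW].
  exists (projH @` V°, W) => /=; first split=> //.
    apply: open_nbhs_nbhs; split; last by exists (hpart u).
    exact/(heis_orbit_proj_open gG)/open_interior.
  move=> [_ t] [/= [h /interior_subset Vh <-] Wt].
  exists (mk4 (ha h) (hb h) (hc h) t); first exact: (VW (h, t)).
  by rewrite /heis_param hpart_mk4 mk4_3.
- move=> [x t]; pose h := orbit_repr x.
  exists (mk4 (ha h) (hb h) (hc h) t); rewrite /heis_param hpart_mk4 mk4_3.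
  by rewrite orbit_reprK.
Qed.

(** Since [3 + 1] computes to [4], a product chart read through [heis_param] can be compared with
    the identity of R^4. In [heis_param_adapted] the local section is accordingly [id]. *)
Lemma heis_prod_chart_val (c : 'rV[R]_3) (u : E) :
  c = \row_(k < 3) nth 0 [:: u 0 0; u 0 1; u 0 2%:R] k ->
  row_mx c (\row_(_ < 1) u 0 3%:R) = u :> 'rV[R]_(3 + 1).
Proof.
move=> ->; apply/rowP => k; rewrite mxE; case: splitP => j kj; rewrite mxE.
  by case: j kj => [[|[|[|//]]] ?] /= kj; congr (u 0 _); apply/val_inj.
by congr (u 0 _); apply/val_inj; rewrite /= kj (ord1 j).
Qed.

Lemma heis_param_adapted e :
  prod_atlas (heis_quotient_atlas G) real_atlas e -> adapted heis_param e.
Proof.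
move=> [c [d [[c0 [W [-> oW _ iW [cW cE]]]] -> ->]]] {e}.
set e := Chart _ _.
have chartE u : W (hpart u) -> e (heis_param u) = u.
  move=> Wu; apply: heis_prod_chart_val; rewrite [LHS]cE//=.
  by rewrite -/(ha _) -/(hb _) -/(hc _) ha_mk hb_mk hc_mk.
have domE x t : chart_dom e (x, t) ->
    exists u, W (hpart u) /\ heis_param u = (x, t).
  move=> [/=]; rewrite cW => -[h Wh <-{x}] _.
  exists (mk4 (ha h) (hb h) (hc h) t); split; first by rewrite hpart_mk4.
  by rewrite /heis_param hpart_mk4 mk4_3.
split.
- rewrite openE => -[x t] [/= Wx _]; exists (chart_dom c, setT) => //=.
  split; last exact: filterT.
  by apply: open_nbhs_nbhs; split=> //; rewrite cW; exact: heis_orbit_proj_open.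
- move=> [x t] [y s] /set_mem/domE[u [Wu <-]] /set_mem/domE[v [Wv <-]].
  by rewrite !chartE// => ->.
- move=> [x t] /domE[u [Wu <-]].
  have nW : \forall z \near u, W (hpart z).
    by apply: continuous_hpart; exact: open_nbhs_nbhs.
  have nE : {near u, id =1 e \o heis_param}.
    by move: nW; apply: filterS => z /chartE.
  have sid : smooth_at (id : E -> E) u.
    by apply/smooth_at_rV => j; exact: smooth_at_coord.
  exists u, id; rewrite chartE//; split=> //.
  + exact: smooth_at_near_eq nE sid.
  + by move: nE; apply: filterS => z /esym.
Qed.

Lemma heis_param_cover y :
  exists2 e, prod_atlas (heis_quotient_atlas G) real_atlas e & chart_dom e y.
Proof.
case: y => x t; rewrite -(orbit_reprK x); set h := orbit_repr x.
have [W [oW Wh iW]] := heis_proj_locally_injective h.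
pose c : chart (R := R) (heis R) 3 := Chart setT (fun h : heis R =>
     let A := heis_val h in
     \row_(k < 3) nth 0 [:: A 0 1; A 1 2%:R; A 0 2%:R] k).
have [|e Ae he] := @orbit_atlas_cover R _ _ (heis_orbit G) 3 heis_atlas c h W
  erefl _ I oW Wh iW; first exact: openT.
pose d : chart (R := R) R 1 := Chart setT (fun t : R => \row_(_ < 1) t).
exists (Chart (chart_dom e `*` chart_dom d)
               (fun p => row_mx (e p.1) (d p.2))) => //.
by exists e, d.
Qed.

End HeisQuotient.

(** * The projective side *)

Section ComplexValued.
Context {R : realType}.
Local Notation C := (Cplx R).

Lemma normc_ge_Im (x : C) : (`|complex.Im x|%:C)%C <= `|x|.
Proof.
by rewrite normc_def lecR -sqrtr_sqr ler_wsqrtr// lerDr sqr_ge0.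
Qed.

Lemma continuous_ReC : continuous (@complex.Re R : C -> R).
Proof.
move=> z A /nbhs_ballP[e /= e0 zA]; apply/nbhs_ballP.
exists (e%:C)%C => /=; first by rewrite ltcR.
move=> y zy; apply: zA; change (`|complex.Re z - complex.Re y| < e).
have {}zy : `|z - y| < (e%:C)%C by exact: zy.
by rewrite -ltcR -raddfB (le_lt_trans (normc_ge_Re _)).
Qed.

Lemma continuous_ImC : continuous (@complex.Im R : C -> R).
Proof.
move=> z A /nbhs_ballP[e /= e0 zA]; apply/nbhs_ballP.
exists (e%:C)%C => /=; first by rewrite ltcR.
move=> y zy; apply: zA; change (`|complex.Im z - complex.Im y| < e).
have {}zy : `|z - y| < (e%:C)%C by exact: zy.
by rewrite -ltcR -raddfB (le_lt_trans (normc_ge_Im _)).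
Qed.

Lemma continuous_real_complex : continuous (fun x : R => (x%:C)%C : C).
Proof.
move=> x A /nbhs_ballP[e /= e0 xA]; apply/nbhs_ballP.
(* Radii of balls in [C] are elements of [C]; a positive one is real. *)
have eE : e = ((complex.Re e)%:C)%C by rewrite RRe_real// gtr0_real.
exists (complex.Re e) => /=; first by rewrite -ltcR -eE.
move=> y xy; apply: xA; change (`|(x%:C)%C - (y%:C)%C : C| < e).
have {}xy : `|x - y| < complex.Re e by exact: xy.
rewrite -rmorphB normc_def /= expr0n /= addr0 sqrtr_sqr eE ltcR //.
Qed.

Lemma continuous_Complex (T : topologicalType) (f g : T -> R) x :
  {for x, continuous f} -> {for x, continuous g} ->
  {for x, continuous (fun y => (f y +i* g y)%C : C)}.
Proof.
move=> cf cg.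
have -> : (fun y => (f y +i* g y)%C : C) =
    (fun y => ((f y)%:C)%C + ('i%C : C) * ((g y)%:C)%C).
  by apply/funext => y; rewrite [LHS]complexE.
apply: (@continuousD _ C).
  by apply: continuous_comp; [exact: cf|exact: continuous_real_complex].
apply: (@continuousM C); first exact: cst_continuous.
by apply: continuous_comp; [exact: cg|exact: continuous_real_complex].
Qed.

(** [smooth_at] expects values in a normed space over [R], whereas [Cplx R] is normed over itself;
    hence the separate real and imaginary parts. *)
Definition csmooth_at (V : normedModType R) (f : V -> C) (x : V) :=
  smooth_at (fun y => complex.Re (f y)) x /\
  smooth_at (fun y => complex.Im (f y)) x.

Lemma csmooth_at_continuous (V : normedModType R) (f : V -> C) x :
  csmooth_at f x -> {for x, continuous f}.
Proof.
move=> [/smooth_at_continuous f1 /smooth_at_continuous f2].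
have -> : f = fun y => (complex.Re (f y) +i* complex.Im (f y))%C.
  by apply/funext => y; case: (f y).
exact: continuous_Complex.
Qed.

Lemma csmooth_atM (V : normedModType R) (f g : V -> C) x :
  csmooth_at f x -> csmooth_at g x -> csmooth_at (fun y => f y * g y) x.
Proof.
move=> [f1 f2] [g1 g2]; split.
- have := smooth_atD (smooth_atM f1 g1) (smooth_atN (smooth_atM f2 g2)).
  apply: smooth_at_near_eq; apply: nearW => y.
  by case: (f y) (g y) => [a b] [c d].
- have := smooth_atD (smooth_atM f1 g2) (smooth_atM f2 g1).
  apply: smooth_at_near_eq; apply: nearW => y.
  by case: (f y) (g y) => [a b] [c d].
Qed.

Lemma csmooth_atV (V : normedModType R) (f : V -> C) x :
  f x != 0 -> csmooth_at f x -> csmooth_at (fun y => (f y)^-1) x.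
Proof.
move=> f0 [f1 f2].
(* The inverse of a complex number is its conjugate over its squared modulus; this is the squared
   modulus of [f x]. *)
have n0 : complex.Re (f x) * complex.Re (f x) +
    complex.Im (f x) * complex.Im (f x) != 0.
  move: f0; case: (f x) => [a b] /=; apply: contraNneq => /eqP.
  by rewrite -!expr2 paddr_eq0 ?sqr_ge0// !sqrf_eq0 => /andP[/eqP-> /eqP->].
have s2 := smooth_atD (smooth_atM f1 f1) (smooth_atM f2 f2).
have := smooth_atV _ s2 => /(_ n0) sn.
split.
- have := smooth_atM f1 sn.
  apply: smooth_at_near_eq; apply: nearW => y.
  by case: (f y) => [a b]; rewrite /= -!expr2.
- have := smooth_atN (smooth_atM f2 sn).
  apply: smooth_at_near_eq; apply: nearW => y.
  by case: (f y) => [a b]; rewrite /= -!expr2.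
Qed.

End ComplexValued.

(** * Homogeneous coordinates on Omega and equivariance *)

Section ProjectiveParametrization.
Context {R : realType}.
Local Notation C := (Cplx R).
Local Notation E := 'rV[R]_4.
Implicit Types u v : E.

(* The image of [(0, i e^t, 1)] under the element [hpart u] of the group. *)
Definition lift3 u : 'cV[C]_3 :=
  \col_(k < 3) nth 0 [:: (u 0 2%:R +i* (u 0 0 * expR (u 0 3%:R)))%C;
                         (u 0 1 +i* expR (u 0 3%:R))%C; 1] k.

(** Solves [w_0 / w_2 = c + i a e^t] and [w_1 / w_2 = b + i e^t] for [(a, b, c, t)]. Only ratios
    occur, so the result depends on the projective class alone. *)
Definition heis_coords (w : 'cV[C]_3) : E :=
  mk4 (complex.Im (w 0 0 / w 2%:R 0) / complex.Im (w 1 0 / w 2%:R 0))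
      (complex.Re (w 1 0 / w 2%:R 0))
      (complex.Re (w 0 0 / w 2%:R 0))
      (ln (complex.Im (w 1 0 / w 2%:R 0))).

(* Since [x / 0 = 0], this entails [w 2 0 != 0]. *)
Definition upper (w : 'cV[C]_3) := 0 < complex.Im (w 1 0 / w 2%:R 0).

Lemma lift3_0 u : lift3 u 0 0 = (u 0 2%:R +i* (u 0 0 * expR (u 0 3%:R)))%C.
Proof. by rewrite mxE. Qed.
Lemma lift3_1 u : lift3 u 1 0 = (u 0 1 +i* expR (u 0 3%:R))%C.
Proof. by rewrite mxE. Qed.
Lemma lift3_2 u : lift3 u 2%:R 0 = 1.
Proof. by rewrite mxE. Qed.
Definition lift3E := (lift3_0, lift3_1, lift3_2).

Lemma upper_lift3 u : upper (lift3 u).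
Proof. by rewrite /upper !lift3E divr1 /= expR_gt0. Qed.

Lemma heis_coordsK u : heis_coords (lift3 u) = u.
Proof.
rewrite /heis_coords !lift3E !divr1 /= mulfK ?expR_eq0// expRK.
by rewrite -mk4_eta.
Qed.

Lemma upper_neq0 w : upper w -> w 2%:R 0 != 0.
Proof.
by rewrite /upper; apply: contraTneq => ->; rewrite invr0 mulr0 /= ltxx.
Qed.

Lemma ratio_scale (l : C) (w : 'cV[C]_3) i j : l != 0 ->
  (l *: w) i 0 / (l *: w) j 0 = w i 0 / w j 0.
Proof. by move=> l0; rewrite !mxE invfM mulrACA divff// mul1r. Qed.

Lemma heis_coords_scale (l : C) w : l != 0 ->
  heis_coords (l *: w) = heis_coords w.
Proof. by move=> l0; rewrite /heis_coords !ratio_scale. Qed.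

Lemma upper_scale (l : C) w : l != 0 -> upper (l *: w) <-> upper w.
Proof. by move=> l0; rewrite /upper ratio_scale. Qed.

Lemma cV3P (v w : 'cV[C]_3) :
  v 0 0 = w 0 0 -> v 1 0 = w 1 0 -> v 2%:R 0 = w 2%:R 0 -> v = w.
Proof.
move=> h0 h1 h2; apply/matrixP => i j; rewrite (ord1 j).
have i3 : [|| i == 0, i == 1 | i == 2%:R] by case: i => [[|[|[|//]]] ?].
by case/or3P: i3 => /eqP ->.
Qed.

Lemma lift3_coords w : upper w -> lift3 (heis_coords w) = (w 2%:R 0)^-1 *: w.
Proof.
move=> Uw; have w2 := upper_neq0 Uw.
have wE i : ((w 2%:R 0)^-1 *: w) i 0 = w i 0 / w 2%:R 0 by rewrite mxE mulrC.
apply: cV3P; rewrite wE lift3E.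
- rewrite !mk4E lnK// divfK; last by rewrite gt_eqF.
  by case: (w 0 0 / _).
- by rewrite !mk4E lnK//; case: (w 1 0 / _).
- by rewrite divff.
Qed.

Lemma lift3_punctured u : lift3 u \in punctured.
Proof.
rewrite inE /=; apply/eqP => /matrixP/(_ 2%:R 0); rewrite lift3E mxE.
by move/eqP; rewrite oner_eq0.
Qed.

Definition plift u : set_type punctured :=
  exist (fun z : 'cV[C]_3 => z \in punctured) (lift3 u) (lift3_punctured u).

Definition Omega : set (projective_plane R) :=
  [set p | upper (set_val (orbit_repr p))].

(** Sets and charts of the projective plane are defined on a chosen representative; this transfers
    their scale-invariant formulas to any vector [w] of the class. *)
Lemma repr_proj_class (w : set_type punctured) : exists2 l : C, l != 0 &
  set_val (orbit_repr (proj_class w)) = l *: set_val w.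
Proof.
set w' := orbit_repr _.
have /orbit_projP e : proj_class w' = proj_class w by exact: orbit_reprK.
have [l /= l0 lE] : scaling_orbit w (set_val w').
  by rewrite -e; exists 1; rewrite /= ?oner_eq0 ?scale1r.
by exists l.
Qed.

Lemma proj_class_scale (l : C) (w w' : set_type punctured) :
  l != 0 -> set_val w' = l *: set_val w -> proj_class w' = proj_class w.
Proof.
move=> l0 lE; apply/orbit_projP/seteqP; split=> _ [k /= k0 <-].
- by exists (k * l); rewrite /= ?mulf_neq0// lE scalerA.
- exists (k / l); first by rewrite /= mulf_neq0 ?invr_eq0.
  by rewrite lE scalerA divfK.
Qed.

Lemma Omega_class (w : set_type punctured) :
  Omega (proj_class w) <-> upper (set_val w).
Proof.
by rewrite /Omega /=; have [l l0 ->] := repr_proj_class w; exact: upper_scale.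
Qed.

Lemma Omega_plift u : proj_class (plift u) \in Omega.
Proof. by apply/mem_set/Omega_class; exact: upper_lift3. Qed.

Definition omega_param u : set_type Omega :=
  exist (fun p => p \in Omega) (proj_class (plift u)) (Omega_plift u).

Definition omega_coords (x : set_type Omega) : E :=
  heis_coords (set_val (orbit_repr (set_val x))).

Lemma omega_paramK : cancel omega_param omega_coords.
Proof.
move=> u; rewrite /omega_coords /=.
have [l l0 lE] := repr_proj_class (plift u).
by rewrite [X in heis_coords X]lE heis_coords_scale// heis_coordsK.
Qed.

Lemma omega_coordsK : cancel omega_coords omega_param.
Proof.
move=> x; have /set_mem Ux := valP x; apply/val_inj => /=.
rewrite -[RHS]orbit_reprK; set w := orbit_repr _.
apply: (@proj_class_scale (set_val w 2%:R 0)^-1).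
  by rewrite invr_eq0; exact: upper_neq0.
exact: lift3_coords.
Qed.

(** The equality already holds between the vectors, without rescaling, because the last row
    [(0, 0, 1)] of [g] keeps the last entry of [lift3 u] equal to 1. *)
Lemma heis_act_omega (g : heis R) u :
  heis_act g (set_val (omega_param u)) = set_val (omega_param (act g u)).
Proof.
rewrite /= [LHS]heis_actE; congr proj_class; apply/val_inj => /=.
rewrite [in LHS](heis_eta g) /heis_val /=.
have mulE i : (complexify (heis_mx (ha g) (hb g) (hc g)) *m lift3 u) i 0 =
    ((heis_mx (ha g) (hb g) (hc g) i 0)%:C)%C * lift3 u 0 0 +
    ((heis_mx (ha g) (hb g) (hc g) i 1)%:C)%C * lift3 u 1 0 +
    ((heis_mx (ha g) (hb g) (hc g) i 2%:R)%:C)%C * lift3 u 2%:R 0.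
  by rewrite mxE !big_ord_recl big_ord0 addr0 addrA !mxE.
apply: cV3P; rewrite mulE !lift3E ?mk4E !mxE /=; apply/eqP;
  rewrite eq_complex /=; apply/andP; split; apply/eqP; ring.
Qed.

End ProjectiveParametrization.

(** * Omega is open and homeomorphic to R^4 *)

Section OmegaTopology.
Context {R : realType}.
Local Notation C := (Cplx R).
Local Notation E := 'rV[R]_4.
Implicit Types u v : E.

Lemma continuous_coordE k : continuous (fun u : E => u 0 k).
Proof. exact: coord_continuous. Qed.

Lemma continuous_exp_coord k : continuous (fun u : E => expR (u 0 k)).
Proof.
move=> u; apply: continuous_comp; first exact: continuous_coordE.
exact: continuous_expR.
Qed.

Lemma continuous_lift3 : continuous (@lift3 R).
Proof.
move=> u; apply: continuous_mx => i j.
have cE (f f' : E -> C) :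
    {for u, continuous f} -> f' =1 f -> {for u, continuous f'}.
  by move=> cf /funext->.
have c0 : {for u, continuous
    (fun u : E => (u 0 2%:R +i* (u 0 0 * expR (u 0 3%:R)))%C : C)}.
  apply: continuous_Complex; first exact: continuous_coordE.
  by apply: continuousM; [exact: continuous_coordE|exact: continuous_exp_coord].
have c1 : {for u, continuous (fun u : E => (u 0 1 +i* expR (u 0 3%:R))%C : C)}.
  apply: continuous_Complex; first exact: continuous_coordE.
  exact: continuous_exp_coord.
have c2 : {for u, continuous (fun u : E => 1 : C)} by exact: cst_continuous.
have i3 : [|| i == 0, i == 1 | i == 2%:R] by case: i => [[|[|[|//]]] ?].
rewrite (ord1 j); case/or3P: i3 => /eqP ->.
- by apply: (cE _ (fun y => lift3 y 0 0) c0) => y; rewrite lift3_0.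
- by apply: (cE _ (fun y => lift3 y 1 0) c1) => y; rewrite lift3_1.
- by apply: (cE _ (fun y => lift3 y 2%:R 0) c2) => y; rewrite lift3_2.
Qed.

Lemma continuous_omega_param : continuous (@omega_param R).
Proof.
move=> u; apply: continuous_set_type => /=.
have cp : {for u, continuous (@plift R)}.
  by apply: continuous_set_type; exact: continuous_lift3.
apply: (@continuous_comp _ _ _ (@plift R) (@proj_class R)) => //.
exact: pi_continuous.
Qed.

Section Ratio.
Context (T : topologicalType) (f : T -> 'cV[C]_3) (x : T).
Hypothesis cf : forall i, {for x, continuous (fun y => f y i 0 : C)}.

Lemma continuous_ratio (i j : 'I_3) : f x j 0 != 0 ->
  {for x, continuous (fun y => f y i 0 / f y j 0 : C)}.
Proof.
move=> fj; apply: (@continuousM C) => //.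
exact: (@continuousV C).
Qed.

Lemma continuous_Re_ratio i j : f x j 0 != 0 ->
  {for x, continuous (fun y => complex.Re (f y i 0 / f y j 0))}.
Proof.
move=> /(@continuous_ratio i) cr.
exact: (continuous_comp cr (@continuous_ReC R _)).
Qed.

Lemma continuous_Im_ratio i j : f x j 0 != 0 ->
  {for x, continuous (fun y => complex.Im (f y i 0 / f y j 0))}.
Proof.
move=> /(@continuous_ratio i) cr.
exact: (continuous_comp cr (@continuous_ImC R _)).
Qed.

Lemma continuous_heis_coords : upper (f x) ->
  {for x, continuous (fun y => heis_coords (f y))}.
Proof.
move=> Ux; have x2 := upper_neq0 Ux.
apply: continuous_mk4;
  [|exact: continuous_Re_ratio|exact: continuous_Re_ratio|].
- apply: continuousM; first exact: continuous_Im_ratio.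
  by apply: continuousV; [rewrite gt_eqF|exact: continuous_Im_ratio].
- apply: (continuous_comp (@continuous_Im_ratio 1 _ x2)).
  exact: continuous_ln.
Qed.

Lemma near_upper : upper (f x) -> \forall y \near x, upper (f y).
Proof.
move=> Ux; have x2 := upper_neq0 Ux.
have /= := @continuous_Im_ratio 1 _ x2 => /(_ [set r | 0 < r]); apply.
exact: lt_nbhsr.
Qed.

End Ratio.

Lemma continuous_punctured_coord i :
  continuous (fun w : set_type (@punctured R) => set_val w i 0 : C).
Proof.
move=> w; apply: (@continuous_comp _ _ _ set_val (fun M : 'cV[C]_3 => M i 0)).
  exact: initial_continuous.
exact: coord_continuous.
Qed.

Lemma proj_open (A : set (projective_plane R)) :
  (forall w, A (proj_class w) -> \forall w' \near w, A (proj_class w')) ->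
  open A.
Proof. by move=> nA; rewrite orbit_openE openE => w /nA. Qed.

Lemma Omega_open : open (@Omega R).
Proof.
apply: proj_open => w /Omega_class Uw.
have := near_upper (f := fun w => set_val w)
  (fun i => @continuous_punctured_coord i w) Uw.
by apply: filterS => w' /Omega_class.
Qed.

Lemma omega_param_open (U : set E) : open U -> open (omega_param @` U).
Proof.
(* Open sets of the subtype are traces of open sets of the plane. [A] is such a set: by scale
   invariance its condition can be checked on [w] itself, where it is open. *)
move=> oU; pose A := [set p : projective_plane R |
  Omega p /\ U (heis_coords (set_val (orbit_repr p)))].
exists A.
  apply: proj_open => w [/Omega_class Uw].
  have [l l0 ->] := repr_proj_class w; rewrite heis_coords_scale// => UFw.
  have cw i : {for w, continuous
      (fun w' : set_type (@punctured R) => set_val w' i 0 : C)}.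
    exact: continuous_punctured_coord.
  have nU := near_upper (f := fun w => set_val w) cw Uw.
  have : \forall w' \near w, U (heis_coords (set_val w')).
    apply: (continuous_heis_coords (f := fun w => set_val w) cw Uw).
    exact: open_nbhs_nbhs.
  move: nU; apply: filterS2 => w' Uw' UFw'; split; first exact/Omega_class.
  by have [l' l'0 ->] := repr_proj_class w'; rewrite heis_coords_scale.
apply/seteqP; split=> [x [_ Ux]|_ [u Uu <-]].
  by exists (omega_coords x) => //; rewrite omega_coordsK.
split; first by apply: set_mem; exact: Omega_plift.
by rewrite [X in U X]omega_paramK.
Qed.

End OmegaTopology.

(** * Affine charts on homogeneous vectors *)

Section AffineCoordinates.
Context {R : realType}.
Local Notation C := (Cplx R).
Local Notation E := 'rV[R]_4.
Implicit Types (i : 'I_3) (w : 'cV[C]_3) (y : 'rV[R]_(2 + 2)).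

Definition affine_coords i w : 'rV[R]_(2 + 2) :=
  row_mx (\row_(j < 2) complex.Re (w (lift i j) 0 / w i 0))
         (\row_(j < 2) complex.Im (w (lift i j) 0 / w i 0)).

Definition affine_lift i y : 'cV[C]_3 :=
  \col_k if unlift i k is Some j
         then (y 0 (lshift 2 j) +i* y 0 (rshift 2 j))%C else 1.

Lemma affine_lift_diag i y : affine_lift i y i 0 = 1.
Proof. by rewrite mxE unlift_none. Qed.

Lemma affine_lift_off i y j :
  affine_lift i y (lift i j) 0 = (y 0 (lshift 2 j) +i* y 0 (rshift 2 j))%C.
Proof. by rewrite mxE liftK. Qed.

Lemma affine_liftK i : cancel (affine_lift i) (affine_coords i).
Proof.
move=> y; apply/rowP => k; rewrite mxE; case: splitP => j kj;
  rewrite mxE affine_lift_diag affine_lift_off divr1 /=;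
  by congr (y 0 _); apply/val_inj.
Qed.

Lemma affine_coordsK i w : w i 0 != 0 ->
  affine_lift i (affine_coords i w) = (w i 0)^-1 *: w.
Proof.
move=> wi; apply/matrixP => k k'; rewrite (ord1 k') [RHS]mxE mulrC.
case: (unliftP i k) => [j|] ->; last by rewrite affine_lift_diag divff.
rewrite affine_lift_off row_mxEl row_mxEr !mxE.
by case: (w _ _ / _).
Qed.

Lemma affine_coords_scale i (l : C) w : l != 0 ->
  affine_coords i (l *: w) = affine_coords i w.
Proof.
by move=> l0; congr row_mx; apply/rowP => j; rewrite [LHS]mxE [RHS]mxE
  ratio_scale.
Qed.

Lemma affine_chart_class i (w : set_type (@punctured R)) :
  affine_chart i (proj_class w) = affine_coords i (set_val w).
Proof.
have [l l0 lE] := repr_proj_class w.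
by rewrite -(affine_coords_scale _ _ l0) -lE.
Qed.

Lemma affine_dom_class i (w : set_type (@punctured R)) :
  chart_dom (affine_chart (R := R) i) (proj_class w) <-> set_val w i 0 != 0.
Proof.
have [l l0 lE] := repr_proj_class w.
change (set_val (orbit_repr (proj_class w)) i 0 != 0 <-> set_val w i 0 != 0).
by rewrite lE mxE mulf_eq0 (negPf l0).
Qed.

Lemma smooth_affine_coords (V : normedModType R) (f : V -> 'cV[C]_3) i x :
  (forall k, csmooth_at (fun z => f z k 0) x) -> f x i 0 != 0 ->
  smooth_at (fun z => affine_coords i (f z)) x.
Proof.
move=> sf fi; have sr k := csmooth_atM (sf k) (csmooth_atV fi (sf i)).
apply/smooth_at_rV => k.
case: (split_ordP k) => j ->.
- have [+ _] := sr (lift i j); apply: smooth_at_near_eq; apply: nearW => z.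
  by rewrite row_mxEl mxE.
- have [_ +] := sr (lift i j); apply: smooth_at_near_eq; apply: nearW => z.
  by rewrite row_mxEr mxE.
Qed.

Lemma smooth_heis_coords (V : normedModType R) (f : V -> 'cV[C]_3) x :
  (forall k, csmooth_at (fun z => f z k 0) x) -> upper (f x) ->
  smooth_at (fun z => heis_coords (f z)) x.
Proof.
move=> sf Ux; have f2 := upper_neq0 Ux.
have [re0 im0] := csmooth_atM (sf 0) (csmooth_atV f2 (sf 2%:R)).
have [re1 im1] := csmooth_atM (sf 1) (csmooth_atV f2 (sf 2%:R)).
apply: smooth_at_mk4 => //.
- by apply: smooth_atM => //; apply: smooth_atV => //; rewrite gt_eqF.
- exact: smooth_at_ln.
Qed.

Lemma csmooth_lift3 (u : E) k : csmooth_at (fun z => lift3 z k 0) u.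
Proof.
have sE (f f' : E -> R) : smooth_at f u -> f' =1 f -> smooth_at f' u.
  by move=> sf /funext->.
have sc j : smooth_at (fun z : E => z 0 j) u by exact: smooth_at_coord.
have se : smooth_at (fun z : E => expR (z 0 3%:R)) u.
  exact: smooth_at_expR.
have k3 : [|| k == 0, k == 1 | k == 2%:R] by case: k => [[|[|[|//]]] ?].
case/or3P: k3 => /eqP ->; split.
- by apply: sE (sc 2%:R) _ => z; rewrite lift3_0.
- by apply: sE (smooth_atM (sc 0) se) _ => z; rewrite lift3_0.
- by apply: sE (sc 1) _ => z; rewrite lift3_1.
- by apply: sE se _ => z; rewrite lift3_1.
- by apply: sE (smooth_at_cst _ _) _ => z; rewrite lift3_2.
- by apply: sE (smooth_at_cst _ _) _ => z; rewrite lift3_2.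
Qed.

Lemma csmooth_affine_lift i y k :
  csmooth_at (fun z => affine_lift i z k 0) y.
Proof.
have sE (f f' : 'rV[R]_(2 + 2) -> R) :
    smooth_at f y -> f' =1 f -> smooth_at f' y.
  by move=> sf /funext->.
have sc j : smooth_at (fun z : 'rV[R]_(2 + 2) => z 0 j) y.
  exact: smooth_at_coord.
case: (unliftP i k) => [j|] ->; split.
- by apply: sE (sc (lshift 2 j)) _ => z; rewrite affine_lift_off.
- by apply: sE (sc (rshift 2 j)) _ => z; rewrite affine_lift_off.
- by apply: sE (smooth_at_cst _ _) _ => z; rewrite affine_lift_diag.
- by apply: sE (smooth_at_cst _ _) _ => z; rewrite affine_lift_diag.
Qed.

End AffineCoordinates.

(** * Omega / G as a quotient of R^4 *)

Section OmegaQuotient.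
Context {R : realType} (G : set (heis R)).
Hypotheses (gG : group_closed [in G]) (dG : G `<=` isolated G).
Local Notation C := (Cplx R).
Local Notation E := 'rV[R]_4.
Local Notation projO := (orbit_proj (@proj_orbit R G (@Omega R))).
Implicit Types u v : E.

Lemma act1 u : act 1%g u = u.
Proof. by apply: hpart_inj; rewrite ?hpart_act ?mul1g// mk4_3. Qed.

Lemma actM g h u : act g (act h u) = act (g * h)%g u.
Proof. by apply: hpart_inj; rewrite ?hpart_act ?mulgA// !mk4_3. Qed.

Lemma Omega_image (p : projective_plane R) :
  Omega p -> exists u, set_val (omega_param u) = p.
Proof.
move=> Op; pose x : set_type (@Omega R) := exist _ p (mem_set Op).
by exists (omega_coords x); rewrite omega_coordsK.
Qed.

Lemma Omega_omega_param u : Omega (set_val (omega_param u)).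
Proof. exact/set_mem/Omega_plift. Qed.

Lemma Omega_invariant (g : heis R) : heis_act g @` @Omega R = @Omega R.
Proof.
apply/seteqP; split=> [_ [_ /Omega_image[u <-] <-]|_ /Omega_image[u <-]].
  by rewrite heis_act_omega; exact: Omega_omega_param.
exists (set_val (omega_param (act g^-1%g u))); first exact: Omega_omega_param.
by rewrite heis_act_omega actM mulgV act1.
Qed.

Definition omega_quot u : domain_quotient G (@Omega R) := projO (omega_param u).

(** By [heis_act_omega] the orbit of [omega_param u] is the image of the orbit of [u] in R^4, and
    [omega_param] is injective. *)
Lemma omega_quotP u v : omega_quot u = omega_quot v <-> act_rel G u v.
Proof.
have oE w : proj_orbit G (omega_param w) =
    [set set_val (omega_param (act g w)) | g in G].
  by apply/seteqP; split=> _ [g Gg <-]; exists g; rewrite // heis_act_omega.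
split=> [/orbit_projP uv|/act_relP[g Gg <-]].
  have : proj_orbit G (omega_param u) (set_val (omega_param v)).
    by rewrite uv oE; exists 1%g; [exact: subgroup1|rewrite act1].
  rewrite oE => -[g Gg /val_inj/(can_inj (@omega_paramK R)) <-].
  exact: act_rel_act.
apply/orbit_projP; rewrite !oE; apply/seteqP; split=> _ [h Gh <-].
- by exists (h * g^-1)%g; [exact: subgroup_div|rewrite actM mulgVK].
- by exists (h * g)%g; [exact: subgroupM|rewrite actM].
Qed.

Lemma omega_quot_deck u v : omega_quot u = omega_quot v ->
  exists h : E -> E,
    [/\ h u = v, smooth_at h u & forall z, omega_quot z = omega_quot (h z)].
Proof.
move=> /omega_quotP/act_relP[g Gg <-]; exists (act g); split=> //.
  exact: smooth_act.
by move=> z; apply/omega_quotP; exact: act_rel_act.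
Qed.

Lemma omega_quot_parametrization : parametrization omega_quot.
Proof.
split.
- move=> u; apply: (@continuous_comp _ _ _ (@omega_param R) projO).
    exact: continuous_omega_param.
  exact: pi_continuous.
- move=> U oU; rewrite orbit_openE.
  (* The saturation of [U] under the action, open because each element of [G] acts continuously on
     R^4. *)
  pose V := [set v | exists2 u, U u & act_rel G v u].
  have -> : projO @^-1` (omega_quot @` U) = @omega_param R @` V.
    apply/seteqP; split=> [x [u Uu ux]|_ [v [u Uu vu] <-]].
      exists (omega_coords x); last exact: omega_coordsK.
      exists u => //; apply/omega_quotP.
      by rewrite /omega_quot omega_coordsK.
    by exists u => //; apply/esym/omega_quotP.
  apply: omega_param_open; rewrite openE => v [u Uu /act_relP[g Gg gvu]].
  have : \forall z \near v, U (act g z).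
    by apply: continuous_act; rewrite gvu; exact: open_nbhs_nbhs.
  by apply: filterS => z Uz; exists (act g z) => //; exact: act_rel_act.
- move=> x; exists (omega_coords (orbit_repr x)).
  by rewrite /omega_quot omega_coordsK orbit_reprK.
Qed.

Lemma omega_quot_adapted e :
  domain_quotient_atlas G (@Omega R) e -> adapted omega_quot e.
Proof.
have [cq oq sq] := omega_quot_parametrization.
move=> [_ [W [[_ [i _ <-] ->] oW Wc iW [eW eE]]]] /=.
pose f u := affine_coords i (lift3 u).
have fE u : W (omega_param u) -> e (omega_quot u) = f u.
  by move=> Wu; rewrite eE//=; exact: (affine_chart_class i (plift u)).
have f0 u : W (omega_param u) -> lift3 u i 0 != 0.
  by move=> /Wc /(affine_dom_class i (plift u)).
(* One formula for all three affine charts: [heis_coords] accepts any representative, here the one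
   with entry 1 at position [i]. *)
pose s := heis_coords \o affine_lift i : 'rV[R]_(2 + 2) -> E.
have sK u : W (omega_param u) -> s (f u) = u.
  move=> /f0 u0; rewrite /s /= affine_coordsK// heis_coords_scale ?invr_eq0//.
  exact: heis_coordsK.
have domE x : chart_dom e x ->
    exists u, W (omega_param u) /\ omega_quot u = x.
  rewrite eW => -[z Wz <-]; exists (omega_coords z).
  by rewrite /omega_quot omega_coordsK.
split.
- rewrite eW (_ : _ @` W = omega_quot @` (omega_param @^-1` W)).
    apply: oq; move/continuousP: (@continuous_omega_param R); exact.
  apply/seteqP; split=> [_ [z Wz <-]|_ [u Wu <-]].
    by exists (omega_coords z); rewrite /omega_quot /= omega_coordsK.
  by exists (omega_param u).
- move=> x y /set_mem/domE[u [Wu <-]] /set_mem/domE[v [Wv <-]].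
  by rewrite !fE// => uv; rewrite -(sK u)// uv sK.
- move=> x /domE[u [Wu <-]].
  have nW : \forall z \near u, W (omega_param z).
    by apply: continuous_omega_param; exact: open_nbhs_nbhs.
  (* This vector is a rescaling of [lift3 u]. Being [upper] is what makes [s] smooth at [f u]. *)
  have Uf : upper (affine_lift i (f u)).
    rewrite /f affine_coordsK ?f0//; apply/upper_scale; last exact: upper_lift3.
    by rewrite invr_eq0 f0.
  have ss : smooth_at s (f u).
    by apply: smooth_heis_coords => // k; exact: csmooth_affine_lift.
  exists u, s; rewrite fE//; split=> //; last 2 first.
  + exact: sK.
  (* The identity [e (omega_quot (s y)) = y] is computed where the lift of [y] is [upper] and [s y]
     returns to the preimage of [W]; both conditions are open. *)
  + have nU : \forall y \near f u, upper (affine_lift i y).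
      apply: near_upper => // k; apply: csmooth_at_continuous.
      exact: csmooth_affine_lift.
    have nWs : \forall y \near f u, W (omega_param (s y)).
      have cs : {for f u, continuous (@omega_param R \o s)}.
        apply: continuous_comp; first exact: smooth_at_continuous.
        exact: continuous_omega_param.
      by apply: cs; rewrite /= sK//; exact: open_nbhs_nbhs.
    move: nU nWs; apply: filterS2 => y Uy Wy; rewrite fE// /f /s /=.
    rewrite lift3_coords// affine_coords_scale ?affine_liftK//.
    by rewrite invr_eq0; exact: upper_neq0.
  + have sf : smooth_at f u.
      by apply: smooth_affine_coords (f0 _ Wu) => k; exact: csmooth_lift3.
    apply: smooth_at_near_eq sf.
    by move: nW; apply: filterS => z /fE.
Qed.

Lemma omega_quot_cover x : exists2 e,
  domain_quotient_atlas G (@Omega R) e & chart_dom e x.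
Proof.
rewrite -(orbit_reprK x); set z := orbit_repr x.
have [W [oW Wz iW]] :=
  heis_proj_locally_injective gG dG (hpart (omega_coords z)).
(* A single affine chart covers [Omega], since [upper] entails that the last entry is nonzero. *)
pose c : chart (R := R) (set_type (@Omega R)) 4 :=
  Chart (set_val @^-1` chart_dom (affine_chart (R := R) 2%:R))
    (affine_chart (R := R) 2%:R \o set_val).
have cT : chart_dom c = setT.
  by apply/seteqP; split=> // y _; have /set_mem/upper_neq0 := valP y.
(* The open set is [W x R] carried to [Omega]. The action fixes [t], so local injectivity on [H] is
   enough. *)
apply: (@orbit_atlas_cover R _ _ _ _ _ c z (omega_param @` (hpart @^-1` W))).
- by exists (affine_chart 2%:R) => //; exists 2%:R.
- by rewrite cT; exact: openT.
- by rewrite cT.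
- apply: omega_param_open; move/continuousP: (@continuous_hpart R); exact.
- by exists (omega_coords z) => //; exact: omega_coordsK.
- move=> _ _ /set_mem[u Wu <-] /set_mem[v Wv <-] /omega_quotP[Gvu uv].
  congr omega_param; apply: hpart_inj uv; apply: iW.
  + exact/mem_set.
  + exact/mem_set.
  + exact/orbit_projP/(heis_orbitP gG).
Qed.

End OmegaQuotient.

Theorem theorem1p4 (R : realType) (G : set (heis R)) (hG : lattice G) :
  exists Omega : set (projective_plane R),
    [/\ open Omega,
        invariant_set G Omega
      & diffeomorphic (domain_quotient_atlas G Omega)
          (prod_atlas (heis_quotient_atlas G) real_atlas)].
Proof.
have [gG dG _] := hG.
exists (@Omega R); split; first exact: Omega_open.
  by move=> g _; exact: Omega_invariant.
apply: (diffeomorphic_parametrization (omega_quot_parametrization gG)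
  (heis_param_parametrization gG)).
- by move=> u v; rewrite omega_quotP// heis_paramP.
- exact: omega_quot_deck.
- move=> u v; rewrite omega_quotP// => /(act_rel_sep gG dG).
  by apply: filterS => z nz /(omega_quotP gG).
- exact: omega_quot_adapted.
- exact: omega_quot_cover.
- exact: heis_param_adapted.
- exact: heis_param_cover.
Qed.
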